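(* Let $f\in C^1([0,1])$ be such that $f'$ is non-constant and of bounded variation. Suppose that there exists a measurable subset $\Lambda$ of $\mathbb{R}^2$ such that the set $$E:=\bigcup_{(a,b)\in\Lambda}\{(x,y)\in\mathbb{R}^2 \mid y=ax+b\}$$ contains the graph of $f$ and $\dim_{\mathcal{H}}(E)<2$. Then the distributional derivative $f''$ of $f'$ is a singular measure.
   Context: $\dim_{\mathcal{H}}$ denotes Hausdorff dimension. Since $f'$ is of bounded variation, its distributional derivative $f''$ is a finite (signed) Radon measure; ''singular'' means singular with respect to Lebesgue measure, i.e. its absolutely continuous part in the Lebesgue decomposition is zero. *)

(* Defs.v *)
From HB Require Import structures.
From mathcomp Require Import all_boot all_order all_algebra.
From mathcomp Require Import all_classical all_reals all_analysis.
Set Implicit Arguments.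
Unset Strict Implicit.
Unset Printing Implicit Defensive.
Import Order.TTheory GRing.Theory Num.Theory.
Import numFieldNormedType.Exports.
Local Open Scope classical_set_scope.
Local Open Scope ring_scope.

(* The plane carries the Euclidean distance; the distance built into the
   library's product type [R * R] is the sup distance. *)
Definition dist2 (R : realType) (p q : R * R) : R :=
  Num.sqrt ((p.1 - q.1) ^+ 2 + (p.2 - q.2) ^+ 2).

(* 0 is included so that the empty set has diameter 0 instead of -oo. *)
Definition diam (R : realType) (U : set (R * R)) : \bar R :=
  ereal_sup ([set 0%E] `|` [set (dist2 p q)%:E | p in U & q in U]).

(* diam(U)^s, with the conventions diam(set0)^0 = 0 and diam({p})^0 = 1 *)
Definition gauge (R : realType) (s : R) (U : set (R * R)) : \bar R :=
  if U == set0 then 0%E else poweR (diam U) s.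

Definition hausdorff_premeasure (R : realType) (s delta : R)
    (A : set (R * R)) : \bar R :=
  ereal_inf [set (\sum_(0 <= i <oo) gauge s (U i))%E |
    U in [set U : nat -> set (R * R) |
      A `<=` \bigcup_i U i /\ forall i, (diam (U i) <= delta%:E)%E]].

Definition hausdorff_measure (R : realType) (s : R)
    (A : set (R * R)) : \bar R :=
  ereal_sup [set hausdorff_premeasure s delta A |
    delta in [set delta : R | 0 < delta]].

Definition hausdorff_dim (R : realType) (A : set (R * R)) : \bar R :=
  ereal_inf [set s%:E |
    s in [set s : R | 0 <= s /\ hausdorff_measure s A = 0%E]].

(* The measurable sets of the product type [R * R] are the Borel sets. *)
Definition lebesgue_measurable2 (R : realType) (A : set (R * R)) : Prop :=
  exists B C : set (R * R),
    [/\ measurable B, measurable C, B `<=` A, A `<=` C &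
        (@lebesgue_measure R \x @lebesgue_measure R)%E (C `\` B) = 0%E].

Definition union_of_lines (R : realType) (L : set (R * R)) : set (R * R) :=
  \bigcup_(ab in L) [set p | p.2 = ab.1 * p.1 + ab.2].

Definition graph01 (R : realType) (f : R -> R) : set (R * R) :=
  [set (x, f x) | x in `[0, 1]].

(* f' is the derivative of f on [0, 1] (one-sided at 0 and 1), and is
   continuous there; values outside [0, 1] are irrelevant. *)
Definition C1_on01 (R : realType) (f f' : R -> R) : Prop :=
  (forall x, x \in `[0, 1] ->
     (fun y => (f y - f x) / (y - x)) @ within `[0, 1] x^' --> f' x) /\
  {within `[0, 1], continuous f'}.

Definition test_function01 (R : realType) (phi : R -> R) : Prop :=
  (forall n x, derivable (derive1n n phi) x 1) /\
  (exists a b : R, [/\ 0 < a, b < 1 & forall x, x \notin `[a, b] -> phi x = 0]).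

(* Integral against a signed measure, through its Jordan decomposition. *)
Definition charge_Rintegral (R : realType)
    (nu : {charge set (measurableTypeR R) -> \bar R})
    (D : set R) (g : R -> R) : R :=
  let nuPN := projT2 (cid (projT2 (cid (Hahn_decomposition nu)))) in
  Rintegral (jordan_pos nuPN) D g - Rintegral (jordan_neg nuPN) D g.

(* The finite signed measure nu is the distributional derivative of g on the
   open interval (0, 1).  A measure on (0, 1) is represented by a measure on R
   that vanishes outside (0, 1). *)
Definition distributional_derivative01 (R : realType) (g : R -> R)
    (nu : {charge set (measurableTypeR R) -> \bar R}) : Prop :=
  (forall A : set (measurableTypeR R),
     measurable A -> A `&` `]0, 1[ = set0 -> nu A = 0%E) /\
  (forall phi : R -> R, test_function01 phi ->
     Rintegral (@lebesgue_measure R) `]0, 1[ (fun x : R => g x * derive1 phi x) =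
     - charge_Rintegral nu `]0, 1[ phi).

(* Mutual singularity with Lebesgue measure: nu is its own singular part in
   the Lebesgue decomposition. *)
Definition singular_charge (R : realType)
    (nu : {charge set (measurableTypeR R) -> \bar R}) : Prop :=
  exists N : set (measurableTypeR R),
    [/\ measurable N, lebesgue_measure N = 0%E &
        forall A, measurable A -> A `<=` ~` N -> nu A = 0%E].

(* Main.v *)
Require Import Defs.
From HB Require Import structures.
From mathcomp Require Import all_boot all_order all_algebra.
From mathcomp Require Import all_classical all_reals all_analysis.
From mathcomp Require Import measurable_realfun ring lra zify.
Import Order.TTheory GRing.Theory Num.Theory.
Import numFieldNormedType.Exports.
Local Open Scope classical_set_scope.
Local Open Scope ring_scope.

(** Write g for f'.  A line of the family through a point (x, f x) either
crosses the graph transversally there or is the tangent at x, and the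
smallness of the union of the lines constrains both kinds.

The geometric input is [expanding_slopes_negligible].  Let lines
y = a(x) t + b(x), with x in a set X of reals, lie in a set of Hausdorff
dimension less than 2, and suppose that the coefficients separate at least
linearly: |a(x) - a(y)| + |b(x) - b(y)| >= c |x - y|.  Then X is Lebesgue
null.  This is Cordoba's L^2 argument for planar Kakeya sets.  Cover the union
by small sets.  For each x some dyadic scale 2^-k covers a definite part of
the line of x, so that this line meets about 2^k grid cells of that scale.
Two lines that are far apart share few cells, so by Cauchy-Schwarz many such
lines force many cells, and the dimension bound leaves room only for few
lines.  Everything is a count of covering intervals, that is, an estimate of
outer measure.

Through nearby points x and y of a differentiable curve, lines that make an
angle bounded below with the curve have coefficients that separate linearly;
hence the points at which the chosen line is transversal form a null set N
([transversal_points_negligible]).  A tangent has slope g(x), so a family of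
tangents is parametrised by its slopes and separates linearly in them; hence
the slopes of the tangents in the family form a null set
([tangent_slopes_negligible]).  Thus g maps the complement of N into a null
set.

The other half is a fact about a continuous function g of bounded variation
and the signed measure nu = dg: if A is Borel and g(A) is null, then
nu(A) = 0 ([null_image_increments_eq]).  On an interval ]p, q[ the image of nu
under g is plus or minus the Lebesgue measure between g(p) and g(q)
([level_pushforward]), because the open set where g > c splits into
intervals, and those with g = c at both ends have nu-mass 0.  Therefore nu
vanishes on the intersection of every interval with the preimage of a null set, hence
on every Borel subset of that preimage.  Applied to Borel sets disjoint from
N, this is the singularity of nu.

The measure nu is the difference of the Stieltjes measures of the total
variation v of g and of v - g, restricted to ]0, 1[; Fubini's theorem gives
the integration by parts that makes it the distributional derivative of g
([stieltjes_by_parts]). *)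

(** * Counting incidences between lines and grid cells *)

(** Rounding the ends of the interval inwards embeds the list into a range of
consecutive integers. *)
Lemma size_int_ball (R : realType) (s : seq int) (r L : R) :
  uniq s -> (forall z, z \in s -> `|z%:~R - r| <= L) ->
  0 <= L -> (size s)%:R <= 2 * L + 1.
Proof.
move=> us sL L0.
have [s0|sn0] := eqVneq s [::]; first by rewrite s0/=; lra.
pose lo := Num.ceil (r - L); pose hi := Num.floor (r + L).
have ins z : z \in s -> (lo <= z <= hi)%R.
  move=> /sL; rewrite ler_distl => /andP[h1 h2].
  by rewrite /lo /hi ceil_le_int floor_ge_int; apply/andP; split; lra.
have lohi : lo <= hi.
  case: s sn0 {us sL} ins => // z s _ /(_ z); rewrite inE eqxx => /(_ isT).
  by move=> /andP[]; exact: le_trans.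
have : (size s <= size [seq (lo + (i%:Z))%R | i <- iota 0 (`|hi - lo|%N).+1])%N.
  apply: uniq_leq_size => // z /ins /andP[h1 h2].
  apply/mapP; exists `|z - lo|%N; last lia.
  by rewrite mem_iota; lia.
rewrite size_map size_iota -(ler_nat R) => /le_trans; apply.
rewrite -natr1 lerD2r.
have -> : (`|hi - lo|%N)%:R = (hi - lo)%:~R :> R.
  by rewrite pmulrn; congr (_ *~ _); lia.
rewrite intrB.
have h1 : hi%:~R <= r + L := floor_le _.
have h2 : r - L <= lo%:~R := ceil_ge _.
by lra.
Qed.

Lemma harmonic_dyadic (R : realType) (k : nat) :
  \sum_(d < 2 ^ k) (1 + d%:R)^-1 <= k.+1%:R :> R.
Proof.
elim: k => [|k IH]; first by rewrite expn0 big_ord1 addr0 invr1.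
rewrite expnS mul2n -addnn big_split_ord /= -natr1 lerD //.
have p0 : (0 : R) < (2 ^ k)%:R by rewrite ltr0n expn_gt0.
apply: (@le_trans _ _ (\sum_(i < 2 ^ k) ((2 ^ k)%:R)^-1)).
  apply: ler_sum => i _; rewrite lef_pV2 ?posrE //.
    by rewrite natrD; have := ler0n R i; lra.
by rewrite sumr_const card_ord -[X in X <= _]mulr_natl divff // gt_eqF.
Qed.

(** At most two grid points lie at each distance from a given one, so the sum
is at most twice a harmonic sum; this logarithm is the usual loss of the planar
Kakeya estimate. *)
Lemma sum_inv_dist (R : realType) (k : nat) (m : 'I_(2 ^ k)) :
  \sum_(m' < 2 ^ k) (1 + `|(m : nat)%:R - (m' : nat)%:R|)^-1 <= 2 * k.+1%:R :> R.
Proof.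
pose F d : R := (1 + d%:R)^-1.
have F0 d : 0 <= F d by rewrite invr_ge0 addr_ge0.
have sumF n : (n <= 2 ^ k)%N -> \sum_(d < n) F d <= k.+1%:R.
  move=> nk; apply: le_trans (harmonic_dyadic R k).
  rewrite -!(big_mkord xpredT F) (big_cat_nat _ nk) //=.
  by rewrite lerDl sumr_ge0.
rewrite -(big_mkord xpredT (fun m' => (1 + `|m%:R - m'%:R|)^-1 : R)).
rewrite (@big_cat_nat _ _ _ m.+1) //=.
rewrite [2]mulr2n mulrDl !mul1r lerD //.
  rewrite big_mkord (reindex_inj rev_ord_inj) /=.
  apply: le_trans (sumF m.+1 (ltn_ord m)).
  apply: ler_sum => i _; rewrite subSS /F -natrB ?leq_subr //.
  by rewrite subKn ?normr_nat // -ltnS.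
rewrite -{1}[m.+1]add0n big_addn big_mkord.
apply: le_trans (sumF _ (leq_subr m.+1 _)).
apply: ler_sum => i _.
rewrite /F lef_pV2 ?posrE ?ltr_pwDl // lerD2l distrC -natrB; last lia.
by rewrite normr_nat ler_nat; lia.
Qed.

(** Cauchy-Schwarz for the number of incidences: a cell that is hit [h] times
contributes [h ^+ 2] pairs of rows, and the pairs are controlled by how many
cells two rows have in common. *)
Lemma incidence_bound (R : realType) (k : nat) (Z : eqType) (P : seq Z)
    (J : {set 'I_(2 ^ k)}) (hit : 'I_(2 ^ k) -> pred Z) (mu A : R) :
  0 <= mu -> 0 <= A ->
  (forall m, m \in J -> mu <= (count (hit m) P)%:R) ->
  (forall m m', m \in J -> m' \in J ->
    (count (predI (hit m) (hit m')) P)%:R *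
      (1 + `|(m : nat)%:R - (m' : nat)%:R|) <= A) ->
  #|J|%:R * mu ^+ 2 <= (size P)%:R * A * (2 * k.+1%:R).
Proof.
move=> mu0 A0 hmu hA.
have [->|J0] := eqVneq J finset.set0.
  by rewrite cards0 mul0r !mulr_ge0.
have nJ : (0 : R) < #|J|%:R by rewrite ltr0n card_gt0.
pose h z : R := \sum_(m in J) (hit m z)%:R.
have countE (p : pred Z) : (count p P)%:R = \sum_(z <- P) (p z)%:R :> R.
  by rewrite -sum1_count big_mkcond natr_sum; apply: eq_bigr => z _; case: (p z).
have sumh : #|J|%:R * mu <= \sum_(z <- P) h z.
  rewrite exchange_big /= mulr_natl -sumr_const ler_sum // => m mJ.
  by rewrite -countE hmu.
have sumh2 : \sum_(z <- P) h z ^+ 2 <= #|J|%:R * (A * (2 * k.+1%:R)).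
  have -> : \sum_(z <- P) h z ^+ 2 =
      \sum_(m in J) \sum_(m' in J) (count (predI (hit m) (hit m')) P)%:R.
    under eq_bigr do rewrite expr2 /h big_distrlr /=.
    rewrite exchange_big /=; apply: eq_bigr => m _.
    rewrite exchange_big /=; apply: eq_bigr => m' _.
    rewrite countE; apply: eq_bigr => z _.
    by rewrite -natrM mulnb.
  rewrite mulr_natl -sumr_const ler_sum // => m mJ.
  apply: (@le_trans _ _ (\sum_(m' in J) A * (1 + `|(m : nat)%:R - (m' : nat)%:R|)^-1)).
    apply: ler_sum => m' m'J; rewrite ler_pdivlMr ?ltr_pwDl //.
    exact: hA.
  rewrite -mulr_sumr ler_wpM2l //; apply: le_trans (sum_inv_dist R k m).
  rewrite big_mkcond ler_sum //= => m' _; case: ifP => // _.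
set S := \sum_(z <- P) h z in sumh; set Q := \sum_(z <- P) _ in sumh2.
have CS : S ^+ 2 <= (size P)%:R * Q.
  have [P0|P0] := eqVneq (size P) 0.
    by rewrite /S /Q (size0nil P0) !big_nil expr0n mulr0.
  have N0 : (0 : R) < (size P)%:R by rewrite ltr0n lt0n.
  set N := (size P)%:R in N0 *.
  have E : \sum_(z <- P) (h z - S / N) ^+ 2 = (N * Q - S ^+ 2) / N.
    transitivity (\sum_(z <- P) (h z ^+ 2 + (- (2 * (S / N)) * h z + (S / N) ^+ 2))).
      by apply: eq_bigr => z _; ring.
    rewrite !big_split /= -mulr_sumr big_const_seq count_predT iter_addr_0.
    rewrite -[X in _ + (_ + X)]mulr_natr -/N -/S -/Q.
    by field; rewrite gt_eqF.
  have : 0 <= \sum_(z <- P) (h z - S / N) ^+ 2 by apply: sumr_ge0 => z _; exact: sqr_ge0.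
  rewrite E.
  by rewrite pmulr_lge0 ?invr_gt0 // subr_ge0.
have := le_trans CS (ler_wpM2l (ler0n _ _) sumh2).
have : (#|J|%:R * mu) ^+ 2 <= S ^+ 2.
  by rewrite ler_sqr ?nnegrE ?mulr_ge0 // (le_trans _ sumh) ?mulr_ge0.
move=> /le_trans h1 /h1.
rewrite exprMn expr2 -mulrA mulrCA -[X in _ <= X]mulrCA.
by rewrite ler_pM2l // !mulrA.
Qed.

Lemma size_le_fibers (R : realType) (S : seq (int * int)) (L : R) :
  (forall p, (count (fun z => z.1 == p) S)%:R <= L) ->
  (size S)%:R <= (size (undup [seq z.1 | z <- S]))%:R * L.
Proof.
move=> fibL; set ps := undup _.
have -> : (size S)%:R = \sum_(p <- ps) (count (fun z => z.1 == p) S)%:R :> R.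
  rewrite -natr_sum; congr _%:R.
  under eq_bigr do rewrite -sum1_count big_mkcond.
  rewrite exchange_big -sum1_size /= big_seq [RHS]big_seq.
  apply: eq_bigr => z zS; rewrite -big_mkcond /= sum1_count.
  rewrite (eq_count (_ : _ =1 pred1 z.1)); last by move=> p; rewrite /= eq_sym.
  by rewrite count_uniq_mem ?undup_uniq // mem_undup map_f.
rewrite mulr_natl -(count_predT ps) -iter_addr_0 -big_const_seq.
exact: ler_sum.
Qed.

(** [line_meets K M l (p, q)] compares the line of coefficients [l] with the
corner (p / M, q / M) of a grid cell of side 1 / M: the line passes at vertical
distance at most K / M from it.  The bound on p keeps the cells near the strip
over the unit interval. *)
Definition line_meets {R : realType} (K M : R) (l : R * R) : pred (int * int) :=
  fun z => (`|z.1%:~R| <= 3 * M) && (`|l.1 * z.1%:~R + l.2 * M - z.2%:~R| <= K).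

(** Two lines whose coefficients differ by about D / M are at distance at most
K / M only over an interval of length about 1 / D, hence only over about M / D
columns of cells, and each column contains boundedly many cells near a line.
If D is bounded the trivial bound by the number of columns suffices; otherwise
one common cell already forces the slopes, and not only the intercepts, to
differ by about D / M. *)
Lemma common_cells (R : realType) (K M c D : R) (l l' : R * R) (P : seq (int * int)) :
  0 < c -> 0 <= K -> 1 <= D -> D <= M -> uniq P ->
  c * (D - 2) <= M * (`|l.1 - l'.1| + `|l.2 - l'.2|) ->
  (count (predI (line_meets K M l) (line_meets K M l')) P)%:R * D <=
  (2 * K + 1) * (29 + 120 * K / c) * M.
Proof.
move=> c0 K0 D1 DM uP sep.
have M1 : 1 <= M by exact: le_trans DM.
rewrite -size_filter; set S := seq.filter _ _.
have uS : uniq S by rewrite filter_uniq.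
have SP z : z \in S -> [/\ `|z.1%:~R| <= 3 * M,
    `|l.1 * z.1%:~R + l.2 * M - z.2%:~R| <= K &
    `|l'.1 * z.1%:~R + l'.2 * M - z.2%:~R| <= K].
  by rewrite mem_filter /= => /andP[/andP[/andP[-> ->] /andP[_ ->]] _].
have Kc0 : 0 <= K / c by rewrite divr_ge0 // ltW.
have sizeS : (size S)%:R <= (size (undup [seq z.1 | z <- S]))%:R * (2 * K + 1).
  apply: size_le_fibers => p; rewrite -size_filter; set Sp := seq.filter _ _.
  rewrite -(size_map snd).
  apply: (@size_int_ball _ _ (l.1 * p%:~R + l.2 * M)) => //.
    rewrite map_inj_in_uniq ?filter_uniq // => -[x y] [x' y'].
    by rewrite !mem_filter /= => /andP[/eqP-> _] /andP[/eqP-> _] ->.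
  move=> y /mapP[z]; rewrite mem_filter => /andP[/eqP zp /SP[_ h _]] ->.
  by rewrite distrC -zp.
set ps := undup _ in sizeS.
have psP p : p \in ps -> exists2 q, `|p%:~R| <= 3 * M & [/\
    `|l.1 * p%:~R + l.2 * M - q| <= K &
    `|l'.1 * p%:~R + l'.2 * M - q| <= K].
  rewrite mem_undup => /mapP[z /SP[h1 h2 h3] ->].
  by exists z.2%:~R.
have ups : uniq ps by rewrite undup_uniq.
suff sps : (size ps)%:R * D <= (29 + 120 * (K / c)) * M.
  rewrite (_ : _ * M = (2 * K + 1) * ((29 + 120 * (K / c)) * M)); last first.
    by rewrite !mulrA.
  apply: le_trans (ler_wpM2r _ sizeS) _; first lra.
  by rewrite mulrAC mulrC ler_wpM2l //; lra.
have [DD0|D0D] := leP D (4 + 8 * (K / c)).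
  have h : (size ps)%:R <= 2 * (3 * M) + 1.
    apply: (@size_int_ball _ _ 0) => //; last lra.
    by move=> p /psP[q h _]; rewrite subr0.
  have h' : (size ps)%:R <= 7 * M by lra.
  apply: (@le_trans _ _ (7 * M * (4 + 8 * (K / c)))).
    by apply: ler_pM => //; lra.
  have : 0 <= M * (K / c) by apply: mulr_ge0 => //; lra.
  nra.
have [s0|sn0] := eqVneq ps [::].
  by rewrite s0 /= mul0r mulr_ge0; lra.
have KcE : K = (K / c) * c by rewrite divfK // gt_eqF.
have diff p : p \in ps -> `|(l.1 - l'.1) * p%:~R + (l.2 - l'.2) * M| <= 2 * K.
  move=> /psP[q _ [h1 h2]].
  rewrite (_ : _ + _ = (l.1 * p%:~R + l.2 * M - q) - (l'.1 * p%:~R + l'.2 * M - q)); last ring.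
  by apply: le_trans (ler_normB _ _) _; lra.
(* the lines come close in a common cell, so their intercepts cannot differ
   much without their slopes differing as well *)
have slope : c * D <= 16 * M * `|l.1 - l'.1|.
  case: ps sn0 {ups sizeS} psP diff => // p ps' _ /(_ p).
  rewrite inE eqxx => /(_ isT)[q p3M _] /(_ p); rewrite inE eqxx => /(_ isT) dp.
  have h : `|(l.2 - l'.2) * M| <= 2 * K + 3 * M * `|l.1 - l'.1|.
    rewrite (_ : _ * M = ((l.1 - l'.1) * p%:~R + (l.2 - l'.2) * M) - (l.1 - l'.1) * p%:~R); last ring.
    apply: le_trans (ler_normB _ _) _; rewrite lerD // normrM mulrC.
    by rewrite ler_wpM2r.
  rewrite normrM (ger0_norm (_ : 0 <= M)) in h; last lra.
  have cD : c * (4 + 8 * (K / c)) <= c * D by rewrite ler_pM2l // ltW.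
  have : c * (K / c) = K by rewrite mulrC -KcE.
  move: h sep cD; set u := `|_|; set v := `|_|; set w := K / c.
  nra.
set al := l.1 - l'.1 in diff slope.
have al0 : 0 < `|al|.
  have cD : 0 < c * D by apply: mulr_gt0 => //; lra.
  rewrite -(@pmulr_rgt0 _ (16 * M)); last lra.
  exact: lt_le_trans cD slope.
have h : (size ps)%:R <= 2 * (2 * K / `|al|) + 1.
  apply: (@size_int_ball _ _ (- ((l.2 - l'.2) * M / al))) => //.
    move=> p /diff; rewrite opprK ler_pdivlMr // -normrM.
    by congr (`|_| <= _); field; rewrite -normr_gt0.
  by apply: divr_ge0; [lra|exact: ltW].
apply: (@le_trans _ _ ((2 * (2 * K / `|al|) + 1) * D)).
  by rewrite ler_wpM2r //; lra.
have : K * D / `|al| <= 16 * M * (K / c).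
  rewrite ler_pdivrMr // {1}KcE -mulrA [X in _ <= X]mulrAC mulrC.
  by rewrite ler_wpM2r.
rewrite (_ : (2 * (2 * K / `|al|) + 1) * D = 4 * (K * D / `|al|) + D); last by field; rewrite gt_eqF.
have : 0 <= M * (K / c) by apply: mulr_ge0 => //; lra.
nra.
Qed.

(** * Dyadic covers of a set of Hausdorff dimension less than 2 *)

Lemma dist2_fst_snd (R : realType) (p q : R * R) :
  `|p.1 - q.1| <= dist2 p q /\ `|p.2 - q.2| <= dist2 p q.
Proof.
rewrite /dist2 -[`|p.1 - q.1|]sqrtr_sqr -[`|p.2 - q.2|]sqrtr_sqr.
by rewrite !ler_wsqrtr // ?lerDl ?lerDr sqr_ge0.
Qed.

Lemma dyadic_scale (R : realType) (d : R) : 0 < d -> d <= 1 ->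
  exists2 k : nat, d * (2 ^ k)%:R <= 1 & 1 < d * (2 ^ k.+1)%:R.
Proof.
move=> d0 d1.
have ex : exists k, 1 < d * (2 ^ k.+1)%:R.
  exists (Num.bound d^-1); rewrite -ltr_pdivrMl // mulr1.
  apply: (lt_le_trans (archi_boundP _)); first by rewrite invr_ge0 ltW.
  by rewrite ler_nat ltnW // (ltn_trans (ltnSn _)) // ltn_expl.
have [k h min] := ex_minnP ex; exists k => //.
case: k h min => [|k] h min; first by rewrite mulr1.
by rewrite leNgt; apply/negP => /min; rewrite ltnn.
Qed.

(** A covering set is replaced by a dyadic square around one of its points.  A
set of diameter 0 may have gauge 0, so it needs an arbitrarily small scale and
the extra room [e]. *)
Lemma dyadic_gauge (R : realType) (s t e : R) (U : set (R * R)) :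
  0 <= s -> s <= t -> 0 < t -> t <= 2 -> 0 < e -> (diam U <= 1%:E)%E ->
  exists (u : R * R) (k : nat),
   (forall p, U p -> `|p.1 - u.1| * (2 ^ k)%:R <= 1 /\ `|p.2 - u.2| * (2 ^ k)%:R <= 1)
   /\ (((2 `^ (- t)) ^+ k)%:E <= 4%:E * gauge s U + e%:E)%E.
Proof.
move=> s0 st t0 t2 e0 dU.
have q0 : 0 < 2 `^ (- t) :> R by rewrite powR_gt0.
have q1 : 2 `^ (- t) < 1 :> R.
  rewrite powRN invf_lt1 ?powR_gt0 //.
  by have := @gt0_ltr_powR R t t0 1 2; rewrite powR1; apply; rewrite ?nnegrE ?ltr1n.
have g0 : (0 <= gauge s U)%E.
  by rewrite /gauge; case: ifP => // _; exact: poweR_ge0.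
have small : exists k, (2 `^ (- t)) ^+ k <= e.
  have : `|2 `^ (- t)| < 1 :> R by rewrite ger0_norm // ltW.
  move=> /cvg_expr /cvgr0Pnorm_lt /(_ _ e0)[k _ /(_ k (leqnn k))] /=.
  by rewrite ger0_norm ?exprn_ge0 ?ltW // => /ltW h; exists k.
have [U0|/set0P[u Uu]] := eqVneq U set0.
  have [k kE] := small; exists (0, 0), k; split; first by rewrite U0.
  apply: (@le_trans _ _ e%:E); first by rewrite lee_fin.
  by rewrite leeDr // mule_ge0.
have d0 : (0 <= diam U)%E by apply: ereal_sup_ubound; left.
have dfin : diam U \is a fin_num by rewrite ge0_fin_numE // (le_lt_trans dU) ?ltry.
have dist p : U p -> `|p.1 - u.1| <= fine (diam U) /\ `|p.2 - u.2| <= fine (diam U).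
  move=> Up; have [h1 h2] := dist2_fst_snd _ p u.
  have : dist2 p u <= fine (diam U).
    by rewrite -lee_fin fineK //; apply: ereal_sup_ubound; right; exists p => //; exists u.
  by split; apply: le_trans; eauto.
move: dU d0 g0 dist; rewrite /gauge ifF; last by apply/negbTE/set0P; exists u.
rewrite -(fineK dfin) /=; set d := fine _ => dU d0 g0 dist; exists u.
rewrite lee_fin in d0; rewrite lee_fin in dU.
have [dE|dn0] := eqVneq d 0.
  have [k kE] := small; exists k; split.
    by move=> p /dist; rewrite dE !normr_le0 => -[/eqP-> /eqP->]; rewrite normr0 mul0r.
  apply: (@le_trans _ _ e%:E); first by rewrite lee_fin.
  by rewrite leeDr // mule_ge0.
have dp : 0 < d by rewrite lt_def dn0.
have [k h1 h2] := @dyadic_scale _ d dp dU; exists k; split.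
  move=> p /dist[p1 p2]; split; apply: le_trans h1;
  by rewrite ler_wpM2r.
rewrite -EFinM -EFinD lee_fin.
apply: (@le_trans _ _ (4 * d `^ s)); last by rewrite lerDl ltW.
apply: (@le_trans _ _ (4 * d `^ t)); last first.
  by rewrite ler_wpM2l // ger_powR // dp.
have q4 : 4^-1 <= 2 `^ (- t) :> R.
  rewrite (_ : 4^-1 = 2 `^ (- 2)); last by rewrite powR_invn // -natrX.
  by rewrite ler_powR ?ler1n // lerN2.
have : (2 `^ (- t)) ^+ k.+1 <= d `^ t.
  have -> : (2 `^ (- t)) ^+ k.+1 = ((2 ^ k.+1)%:R^-1) `^ t :> R.
    rewrite -powR_mulrn ?powR_ge0 // -powRrM natrX -powR_mulrn // -powRN -powRrM.
    by rewrite mulrC mulrN mulNr.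
  rewrite ge0_ler_powR ?nnegrE ?invr_ge0 //; first exact: ltW.
  by rewrite -(@ler_pM2r _ (2 ^ k.+1)%:R) ?ltr0n ?expn_gt0 // mulVf ?pnatr_eq0 -?lt0n ?expn_gt0 // ltW.
rewrite exprS.
have : 0 <= (2 `^ (- t)) ^+ k :> R by rewrite exprn_ge0 // ltW.
by nra.
Qed.

(** The form in which the dimension bound is used: [q] is 2 `^ (- t) for an
exponent t < 2, so that [4^-1 < q] records the gain over the trivial count of
4 ^ k cells.  A cell of [P k] stands for the dyadic square with lower left corner
(z.1, z.2) / 2 ^ k, enlarged by a bounded factor. *)
Lemma dyadic_cover (R : realType) (E : set (R * R)) :
  (hausdorff_dim E < 2%:E)%E ->
  exists q : R, [/\ 4^-1 < q, q < 1 & forall eta, 0 < eta ->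
    exists P : nat -> seq (int * int),
      (forall k, uniq (P k) /\ (size (P k))%:R * q ^+ k <= eta) /\
      (forall p, E p -> exists k z, [/\ z \in P k,
         `|p.1 * (2 ^ k)%:R - z.1%:~R| <= 2 &
         `|p.2 * (2 ^ k)%:R - z.2%:~R| <= 2])].
Proof.
move=> /ereal_inf_lt[_ /= [s [s0 Hs0] <-]]; rewrite lte_fin => s2.
(* a positive exponent, so that small scales have small weight *)
pose t := Num.max s 1.
have st : s <= t by rewrite le_max lexx.
have t0 : 0 < t by rewrite lt_max ltr01 orbT.
have t2 : t < 2 by rewrite gt_max s2 ltr1n.
pose q : R := 2 `^ (- t).
have q0 : 0 < q by rewrite powR_gt0.
have powlt u v : u < v -> 2 `^ (- v) < 2 `^ (- u) :> R.
  move=> uv; have v0 : 0 < v - u by rewrite subr_gt0.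
  have -> : - v = - u - (v - u) by ring.
  rewrite powRB; last by rewrite pnatr_eq0 implybT.
  rewrite ltr_pdivrMr ?powR_gt0 // ltr_pMr ?powR_gt0 //.
  by have := @gt0_ltr_powR R _ v0 1 2; rewrite powR1; apply; rewrite ?nnegrE ?ltr1n.
exists q; split.
- by rewrite (_ : 4^-1 = 2 `^ (- 2)) ?powlt // powR_invn // -natrX.
- by rewrite -[X in _ < X](powRr0 2) -oppr0 powlt.
move=> eta eta0.
(* the diameter bound 1 makes all the scales k natural numbers *)
have [U [EU dU sumU]] : exists U : nat -> set (R * R), [/\ E `<=` \bigcup_i U i,
    forall i, (diam (U i) <= 1%:E)%E &
    (\sum_(0 <= i <oo) gauge s (U i) < (eta / 8)%:E)%E].
  have : (hausdorff_premeasure s 1 E < (eta / 8)%:E)%E.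
    apply: (@le_lt_trans _ _ 0%E); last by rewrite lte_fin divr_gt0.
    rewrite -Hs0 /hausdorff_measure; apply: ereal_sup_ubound.
    by exists 1 => /=.
  by move=> /ereal_inf_lt[_ [U [EU dU] <-] h]; exists U.
pose e i := eta / 2 / (2 ^ i.+1)%:R.
have e0 i : 0 < e i by rewrite !divr_gt0 // ltr0n expn_gt0.
have [uk ukP] : exists uk : nat -> (R * R) * nat, forall i,
    (forall p, U i p -> `|p.1 - (uk i).1.1| * (2 ^ (uk i).2)%:R <= 1 /\
      `|p.2 - (uk i).1.2| * (2 ^ (uk i).2)%:R <= 1)
   /\ ((q ^+ (uk i).2)%:E <= 4%:E * gauge s (U i) + (e i)%:E)%E.
  have H i : exists x : (R * R) * nat, 
    (forall p, U i p -> `|p.1 - x.1.1| * (2 ^ x.2)%:R <= 1 /\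
      `|p.2 - x.1.2| * (2 ^ x.2)%:R <= 1)
   /\ ((q ^+ x.2)%:E <= 4%:E * gauge s (U i) + (e i)%:E)%E.
    have [u [k h]] := @dyadic_gauge _ _ _ _ (U i) s0 st t0 (ltW t2) (e0 i) (dU i).
    by exists (u, k).
  by have [f fP] := choice H; exists f.
have g0 i : (0 <= gauge s (U i))%E.
  by rewrite /gauge; case: ifP => // _; exact: poweR_ge0.
have partial n : \sum_(0 <= i < n) q ^+ (uk i).2 <= eta.
  rewrite -lee_fin -sumEFin.
  apply: (@le_trans _ _ (\sum_(0 <= i < n) (4%:E * gauge s (U i) + (e i)%:E))%E).
    by apply: lee_sum => i _; exact: (ukP i).2.
  apply: le_trans (nneseries_lim_ge _ _) _.
    by move=> i _ _; rewrite adde_ge0 // ?mule_ge0 // lee_fin ltW.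
  apply: le_trans (epsilon_trick _ _ _) _.
  - by move=> i; rewrite mule_ge0.
  - by rewrite divr_ge0 // ltW.
  rewrite nneseriesZl //.
  rewrite (_ : eta%:E = 4%:E * (eta / 8)%:E + (eta / 2)%:E)%E; last first.
    by rewrite -EFinM -EFinD; congr EFin; field.
  by rewrite leeD2r // lee_wpmul2l // ltW.
have fin k : exists N, forall i, (N <= i)%N -> (uk i).2 != k.
  have cv : cvgn (series (fun i => q ^+ (uk i).2)).
    apply: nondecreasing_is_cvgn.
      by apply/nondecreasing_seqP => n; rewrite seriesSr lerDl exprn_ge0 // ltW.
    by exists eta => _ [n _ <-]; exact: partial.
  have /cvgr0Pnorm_lt /(_ _ (exprn_gt0 k q0))[N _ NP] := cvg_series_cvg_0 cv.
  exists N => i /NP /=; apply: contraTneq => ->.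
  by rewrite ger0_norm ?ltxx // exprn_ge0 // ltW.
have [N NP] := choice fin.
pose cell i : int * int := (Num.floor ((uk i).1.1 * (2 ^ (uk i).2)%:R),
                           Num.floor ((uk i).1.2 * (2 ^ (uk i).2)%:R)).
exists (fun k => undup [seq cell i | i <- iota 0 (N k) & (uk i).2 == k]); split.
  move=> k; split; first exact: undup_uniq.
  apply: le_trans (partial (N k)).
  rewrite /index_iota subn0 [X in _ <= X](bigID (fun i => (uk i).2 == k)) /=.
  rewrite -[X in X <= _]addr0 lerD //; last first.
    by apply: sumr_ge0 => i _; rewrite exprn_ge0 // ltW.
  rewrite (eq_bigr (fun=> q ^+ k)); last by move=> i /eqP->.
  rewrite -big_filter big_const_seq count_predT iter_addr_0 -[X in _ <= X]mulr_natl.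
  rewrite ler_wpM2r ?exprn_ge0 ?(ltW q0) // ler_nat.
  by rewrite (leq_trans (size_undup _)) // size_map.
move=> p /EU[i _ /(ukP i).1[h1 h2]]; exists (uk i).2, (cell i).
have near (x u m : R) : 0 <= m -> `|x - u| * m <= 1 -> `|x * m - (Num.floor (u * m))%:~R| <= 2.
  move=> m0; rewrite -[X in _ * X <= _](ger0_norm m0) -normrM.
  have := floor_le (u * m); have := floorD1_gt (u * m); rewrite intrD.
  rewrite !ler_norml mulrBl => f1 f2 /andP[x1 x2]; apply/andP; split; lra.
split; [|exact: near|exact: near].
rewrite mem_undup; apply/mapP; exists i => //.
rewrite mem_filter eqxx mem_iota add0n /= ltnNge; apply/negP => /NP.
by rewrite eqxx.
Qed.

(** * Expanding families of lines inside a set of dimension less than 2 *)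

Lemma negligible_small (R : realType) (X : set R) :
  (forall e : R, 0 < e -> exists A : set R,
     [/\ measurable A, X `<=` A & (lebesgue_measure A <= e%:E)%E]) ->
  (@lebesgue_measure R).-negligible X.
Proof.
move=> small.
have [A AP] := choice (fun n => small (n.+1%:R^-1) (ltac:(by rewrite invr_gt0))).
exists (\bigcap_n A n); split.
- by apply: bigcapT_measurable => n; have [] := AP n.
- apply/eqP; rewrite eq_le measure_ge0 andbT.
  apply/lee_addgt0Pr => e e0; rewrite add0e.
  have [mA _ le] := AP (Num.bound e^-1).
  apply: (@le_trans _ _ (lebesgue_measure (A (Num.bound e^-1)))).
    apply: le_measure; rewrite ?inE //.
    - by apply: bigcapT_measurable => n; have [] := AP n.
    - by apply: bigcap_inf.
  apply: le_trans le _; rewrite lee_fin -[leRHS]invrK lef_pV2 ?posrE ?invr_gt0 //.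
  apply: ltW; apply: lt_le_trans (archi_boundP _) _; first by rewrite invr_ge0 ltW.
  by rewrite ler_nat.
- by move=> x Xx n _; have [_ h _] := AP n; exact: h.
Qed.

Lemma measure_bigsetU_le (R : realType) (T : Type) (s : seq T) (I : T -> set R) (r : R) :
  (forall z, measurable (I z)) -> (forall z, (lebesgue_measure (I z) <= r%:E)%E) ->
  measurable (\big[setU/set0]_(z <- s) I z) /\
  (lebesgue_measure (\big[setU/set0]_(z <- s) I z) <= ((size s)%:R * r)%:E)%E.
Proof.
move=> mI Ir; elim: s => [|z s [IH1 IH2]].
  by rewrite big_nil measure0 mul0r.
rewrite big_cons; split; first exact: measurableU.
apply: le_trans (measureU2 _ _ _) _; [exact: mI|exact: IH1|].
by rewrite /= -natr1 mulrDl mul1r addrC EFinD leeD.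
Qed.

Lemma measure_cover_le (R : realType) (A : nat -> set R) (w : nat -> R) (e : R) :
  (forall k, measurable (A k)) -> (forall k, (lebesgue_measure (A k) <= (w k)%:E)%E) ->
  (forall n, \sum_(k < n) w k <= e) ->
  (lebesgue_measure (\bigcup_k A k) <= e%:E)%E.
Proof.
move=> mA Aw we; have mU : measurable (\bigcup_k A k) by exact: bigcupT_measurable.
have Boole := @le_mu_bigcup _ _ _ (@lebesgue_measure R) A mA mU.
apply: (le_trans Boole).
apply: lime_le; first exact: is_cvg_nneseries.
apply: nearW => n; apply: (@le_trans _ _ (\sum_(0 <= k < n) (w k)%:E)%E).
  by apply: lee_sum => i _; exact: Aw.
by rewrite big_mkord sumEFin lee_fin.
Qed.

(** If every scale covered less than its share [w k] of the line, the covering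
intervals would have total length less than 1 and could not cover the unit
interval. *)
Lemma exists_rich_scale (R : realType) (P : nat -> seq (int * int)) (w : nat -> R) (B : R)
    (l : R * R) :
  (forall n, \sum_(k < n) w k <= 2^-1) -> `|l.1| <= B ->
  (forall t, 0 <= t <= 1 -> exists k z, [/\ z \in P k,
         `|t * (2 ^ k)%:R - z.1%:~R| <= 2 &
         `|(l.1 * t + l.2) * (2 ^ k)%:R - z.2%:~R| <= 2]) ->
  exists k, w k * (2 ^ k)%:R <=
    4 * (count (line_meets (2 * B + 2) (2 ^ k)%:R l) (P k))%:R.
Proof.
move=> sw lB cover; apply: contrapT => /forallNP none.
pose M k : R := (2 ^ k)%:R.
have M1 k : 1 <= M k by rewrite /M ler1n expn_gt0.
have M0 k : 0 < M k by exact: lt_le_trans (M1 k).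
pose I k (z : int * int) : set R := `[(z.1%:~R - 2) / M k, (z.1%:~R + 2) / M k]%classic.
pose A k := \big[setU/set0]_(z <- seq.filter (line_meets (2 * B + 2) (M k) l) (P k)) I k z.
have AP k : measurable (A k) /\ (lebesgue_measure (A k) <= (w k)%:E)%E.
  have [||h1 h2] := @measure_bigsetU_le R _
    (seq.filter (line_meets (2 * B + 2) (M k) l) (P k)) (I k) (4 / M k).
  - by move=> z; exact: measurable_itv.
  - move=> z; rewrite /I lebesgue_measure_itv /=; case: ifPn => _ //.
      by rewrite -EFinD lee_fin -mulrBl (_ : _ - _ = 4) //; ring.
    by rewrite lee_fin divr_ge0 // ltW.
  split=> //; apply: le_trans h2 _; rewrite lee_fin size_filter.
  have /negP := none k; rewrite -ltNge -/(M k) => /ltW h.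
  by rewrite mulrA ler_pdivrMr // mulrC.
have : (lebesgue_measure (`[0%R, 1%R]%classic : set R) <= (2^-1)%:E)%E.
  apply: (@le_trans _ _ (lebesgue_measure (\bigcup_k A k))); last first.
    apply: (@measure_cover_le _ _ w) => //.
      by move=> k; have [] := AP k.
    by move=> k; have [] := AP k.
  apply: le_measure; rewrite ?inE.
  - exact: measurable_itv.
  - by apply: bigcupT_measurable => k; have [] := AP k.
  move=> t /=; rewrite in_itv /= => t01; have [k [z [zP z1 z2]]] := cover t t01.
  exists k => //; rewrite /A -bigcup_seq; exists z; last first.
    rewrite /I /= in_itv /= ler_pdivrMr // ler_pdivlMr //.
    by move: z1; rewrite distrC ler_distl => /andP[]; rewrite -/(M k); lra.
  rewrite /= mem_filter zP andbT /line_meets -/(M k).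
  rewrite -/(M k) in z1 z2; have := M1 k; have := M0 k; set m := M k in z1 z2 *.
  move=> m0 m1; apply/andP; split.
    have : `|t * m| <= m.
      by case/andP: t01 => t0 t1; rewrite ger0_norm ?mulr_ge0 ?(ltW m0) // ler_piMl // ltW.
    move: z1; rewrite ler_distl ler_norml => /andP[h1 h2] /andP[h3 h4].
    rewrite ler_norml; apply/andP; split; lra.
  rewrite (_ : _ - _ = ((l.1 * t + l.2) * m - z.2%:~R) - l.1 * (t * m - z.1%:~R)); last ring.
  apply: le_trans (ler_normB _ _) _; rewrite addrC lerD // normrM mulrC.
  by apply: ler_pM.
rewrite lebesgue_measure_itv /= lte_fin ltr01 oppr0 adde0 lee_fin.
by rewrite leNgt invf_lt1 // ltr1n.
Qed.

Lemma geometric_partial_le (R : realType) (r : R) (n : nat) :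
  0 < r -> r < 1 -> \sum_(k < n) r ^+ k <= (1 - r)^-1.
Proof.
move=> r0 r1; have r1' : 0 < 1 - r by rewrite subr_gt0.
rewrite -[leRHS]mul1r ler_pdivlMr // mulrC -opprB mulNr -subrX1 opprB.
by rewrite gerBl exprn_ge0 // ltW.
Qed.

(** Comparing [rho ^+ k] with each of the previous powers. *)
Lemma succ_geometric_le (R : realType) (r : R) (k : nat) :
  0 < r -> r < 1 -> k.+1%:R * r ^+ k <= (1 - r)^-1.
Proof.
move=> r0 r1; apply: le_trans (@geometric_partial_le _ _ k.+1 r0 r1).
rewrite mulr_natl -[X in _ *+ X]card_ord -sumr_const; apply: ler_sum => i _.
by rewrite ler_wiXn2l // ?(ltW r0) ?(ltW r1) // -ltnS.
Qed.

(** With rho ^+ 4 = 1 / (4 q) < 1, a line that is covered up to its share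
w rho ^+ k at scale k meets about w (2 rho) ^ k cells.  By [incidence_bound] and
[common_cells] at most a multiple of eta rho ^ k 2 ^ k grid intervals of length
2 ^- k can contain parameters of such lines, the factor k + 1 of the harmonic
sum being absorbed by one power of rho ^ k.  So X is covered by intervals of
total length at most a multiple of eta. *)
Lemma expanding_slopes_negligible (R : realType) (L : set (R * R)) (X : set R)
    (u B c : R) (l : R -> R * R) :
  (hausdorff_dim (union_of_lines L) < 2%:E)%E -> 0 < c -> 0 <= B ->
  (forall x, X x -> [/\ u <= x < u + 1, L (l x) & `|(l x).1| <= B]) ->
  (forall x y, X x -> X y ->
     c * `|x - y| <= `|(l x).1 - (l y).1| + `|(l x).2 - (l y).2|) ->
  (@lebesgue_measure R).-negligible X.
Proof.
move=> /dyadic_cover[q [q4 q1 dcover]] c0 B0 XP sep.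
have q0 : 0 < q by apply: lt_trans q4.
pose rho := Num.sqrt (Num.sqrt ((4 * q)^-1)).
have tau0 : 0 < (4 * q)^-1 by rewrite invr_gt0 mulr_gt0.
have rho0 : 0 < rho by rewrite /rho !sqrtr_gt0.
have rhoE : rho ^+ 4 = (4 * q)^-1.
  by rewrite (exprM rho 2 2) sqr_sqrtr ?sqrtr_ge0 // sqr_sqrtr ?(ltW tau0).
have rho4 : q * (4 * rho ^+ 4) = 1.
  by rewrite rhoE; field; rewrite gt_eqF.
have rho1 : rho < 1.
  rewrite -(@ltr_pXn2r _ 4) ?nnegrE ?(ltW rho0) // expr1n rhoE.
  by rewrite invf_lt1 ?mulr_gt0 // -ltr_pdivrMl // mulr1.
pose w := (1 - rho) / 2.
have w0 : 0 < w by rewrite divr_gt0 // subr_gt0.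
have w2 : 2 * w = 1 - rho by rewrite /w; field.
pose K := 2 * B + 2.
pose C1 := (2 * K + 1) * (29 + 120 * K / c).
have K0 : 0 <= K by rewrite /K; lra.
have C10 : 0 < C1.
  have : 0 <= 120 * K / c by rewrite divr_ge0 ?(ltW c0) // mulr_ge0.
  by move=> ?; rewrite /C1 mulr_gt0 //; lra.
apply: negligible_small => e e0.
(* the constant of the final estimate, so that the total length is e *)
pose eta := e * w ^+ 4 / (8 * C1).
have eta0 : 0 < eta by rewrite divr_gt0 // mulr_gt0 // exprn_gt0.
have [P [Psize Pcover]] := dcover eta eta0.
pose M k : R := (2 ^ k)%:R.
have M1 k : 1 <= M k by rewrite /M ler1n expn_gt0.
have M0 k : 0 < M k by exact: lt_le_trans (M1 k).
pose meets x k := line_meets K (M k) (l x).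
pose Xk k := [set x | X x /\ w * rho ^+ k * M k <= 4 * (count (meets x k) (P k))%:R].
have XXk x : X x -> exists k, Xk k x.
  move=> Xx; have [_ Lx lB] := XP x Xx.
  have [||k kP] := @exists_rich_scale R P (fun k => w * rho ^+ k) B (l x) _ lB.
  - move=> n; rewrite -mulr_sumr; apply: (@le_trans _ _ (w * (1 - rho)^-1)).
      by rewrite ler_wpM2l ?(ltW w0) // geometric_partial_le.
    by rewrite -w2 invfM mulrCA divff ?mulr1 // gt_eqF.
  - move=> t _; apply: (Pcover (t, (l x).1 * t + (l x).2)).
    by exists (l x).
  by exists k.
(* the grid intervals containing the parameter of a line rich at scale k *)
pose J k := [set m : 'I_(2 ^ k) | `[< exists2 x, Xk k x &
  (m : nat)%:R <= (x - u) * M k < (m : nat)%:R + 1 >] ]%SET.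
have cardJ k : #|J k|%:R <= 16 * eta * C1 * M k * rho ^+ k / w ^+ 3.
  have [xm xmP] : exists xm : 'I_(2 ^ k) -> R, forall m, m \in J k ->
      Xk k (xm m) /\ (m : nat)%:R <= (xm m - u) * M k < (m : nat)%:R + 1.
    have H (m : 'I_(2 ^ k)) : exists x, m \in J k ->
      Xk k x /\ (m : nat)%:R <= (x - u) * M k < (m : nat)%:R + 1.
      have [|/negP h] := boolP (m \in J k); last by exists 0.
      by rewrite inE => /asboolP[x x1 x2]; exists x.
    by have [f fP] := choice H; exists f.
  have := @incidence_bound R k _ (P k) (J k) (fun m => meets (xm m) k)
     (w * rho ^+ k * M k / 4) (C1 * M k).
  have wr0 : 0 < w * rho ^+ k by rewrite mulr_gt0 // exprn_gt0.
  move=> /(_ (divr_ge0 (mulr_ge0 (ltW wr0) (ltW (M0 k))) (ler0n _ 4))).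
  move=> /(_ (mulr_ge0 (ltW C10) (ltW (M0 k)))).
  have h1 m : m \in J k -> w * rho ^+ k * M k / 4 <= (count (meets (xm m) k) (P k))%:R.
    by move=> /xmP[[_ h] _]; rewrite ler_pdivrMr // [leRHS]mulrC.
  have h2 m m' : m \in J k -> m' \in J k ->
     (count (predI (meets (xm m) k) (meets (xm m') k)) (P k))%:R *
      (1 + `|(m : nat)%:R - (m' : nat)%:R|) <= C1 * M k.
    move=> /xmP[[Xm _] /andP[m1 m2]] /xmP[[Xm' _] /andP[m1' m2']].
    have [uP _] := Psize k.
    apply: common_cells => //.
    - by rewrite lerDl.
    - have lt (i : 'I_(2 ^ k)) : (i : nat)%:R + 1 <= M k by rewrite /M natr1 ler_nat.
      have := lt m; have := lt m'; have := ler0n R m; have := ler0n R m'.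
      by move=> a1 a2 a3 a4; rewrite -lerBrDl ler_norml; apply/andP; split; lra.
    - apply: le_trans (ler_wpM2l (ltW (M0 k)) (sep _ _ Xm Xm')).
      rewrite mulrCA ler_pM2l // -(ger0_norm (ltW (M0 k))) -normrM.
      move: m1 m2 m1' m2'; set a := (m : nat)%:R; set b := (m' : nat)%:R.
      move=> m1 m2 m1' m2'.
      have : `|a - b| <= `|M k * (xm m - xm m')| + 1.
        have := ler_norm (M k * (xm m - xm m')); have := ler_norm (- (M k * (xm m - xm m'))).
        rewrite normrN => n1 n2; rewrite ler_norml; apply/andP; split; lra.
      by lra.
  move=> /(_ h1 h2).
  have [_ sP] := Psize k.
  have := @succ_geometric_le R rho k rho0 rho1; rewrite -w2.
  have r0 : 0 < rho ^+ k by rewrite exprn_gt0.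
  (* here q ^+ k = (4 ^ k * rho ^+ (4 * k))^-1, by the choice of rho *)
  have N : (size (P k))%:R <= eta * M k ^+ 2 * (rho ^+ k) ^+ 4.
    have E : M k ^+ 2 * (rho ^+ k) ^+ 4 = (q ^+ k)^-1.
      apply: (mulfI (lt0r_neq0 (exprn_gt0 k q0))).
      rewrite divff ?gt_eqF ?exprn_gt0 // /M natrX -!exprM [(k * 2)%N]mulnC [(k * 4)%N]mulnC.
      by rewrite !exprM -!exprMn (_ : 2 ^+ 2 = 4) ?rho4 ?expr1n //; ring.
    by rewrite -mulrA E ler_pdivlMr // exprn_gt0.
  set r := rho ^+ k in r0 wr0 N *; set m := M k in N *; set n := #|J k|%:R.
  set S := (size _)%:R in N *; set k1 := k.+1%:R => kr H.
  have m0 : 0 < m := M0 k.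
  have X0 : 0 < (w * r * m / 4) ^+ 2 by rewrite exprn_gt0 // divr_gt0 // mulr_gt0.
  rewrite -(ler_pM2r X0); apply: le_trans H _.
  apply: (@le_trans _ _ (eta * m ^+ 2 * r ^+ 4 * (C1 * m) * (2 * k1))).
    by rewrite ler_wpM2r ?mulr_ge0 // ler_wpM2r // mulr_ge0 // ltW.
  rewrite (_ : _ * (2 * k1) = (2 * eta * C1 * m ^+ 3 * r ^+ 3) * (k1 * r)); last ring.
  rewrite (_ : _ * (w * r * m / 4) ^+ 2 = (2 * eta * C1 * m ^+ 3 * r ^+ 3) * (2 * w)^-1); last first.
    by field; rewrite gt_eqF.
  apply: ler_wpM2l => //; apply: ltW.
  apply: mulr_gt0; last exact: exprn_gt0.
  apply: mulr_gt0; last exact: exprn_gt0.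
  by apply: mulr_gt0 => //; apply: mulr_gt0.
pose I k (m : 'I_(2 ^ k)) : set R := `[u + (m : nat)%:R / M k, u + ((m : nat)%:R + 1) / M k]%classic.
pose A k := \big[setU/set0]_(m <- enum (J k)) I k m.
have AP k : measurable (A k) /\ (lebesgue_measure (A k) <= (16 * eta * C1 / w ^+ 3 * rho ^+ k)%:E)%E.
  have [||h1 h2] := @measure_bigsetU_le R _ (enum (J k)) (I k) ((M k)^-1).
  - by move=> z; exact: measurable_itv.
  - move=> z; rewrite /I lebesgue_measure_itv /=; case: ifPn => _ //.
      by rewrite -EFinD lee_fin opprD addrACA subrr add0r -mulrBl addrAC subrr add0r mul1r.
    by rewrite lee_fin invr_ge0 ltW.
  split=> //; apply: le_trans h2 _; rewrite lee_fin -cardE ler_pdivrMr //.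
  apply: le_trans (cardJ k) _; rewrite le_eqVlt; apply/orP; left; apply/eqP.
  by field; rewrite gt_eqF.
exists (\bigcup_k A k); split.
- by apply: bigcupT_measurable => k; have [] := AP k.
- move=> x Xx; have [k Xkx] := XXk x Xx; exists k => //.
  have [/andP[ux xu] _ _] := XP x Xx.
  have xM0 : 0 <= (x - u) * M k by rewrite mulr_ge0 ?subr_ge0 // ltW.
  have xM1 : (x - u) * M k < M k by rewrite gtr_pMl //; lra.
  have := truncn_itv xM0 => /andP[t1 t2].
  have tlt : (Num.truncn ((x - u) * M k)%R < 2 ^ k)%N.
    by rewrite -(ltr_nat R); apply: le_lt_trans t1 xM1.
  rewrite /A -bigcup_seq; exists (Ordinal tlt) => /=.
    by rewrite mem_enum inE; apply/asboolP; exists x => //; rewrite t1 natr1.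
  rewrite /I /= in_itv /=; apply/andP; split.
    by rewrite -lerBrDl ler_pdivrMr.
  by rewrite -lerBlDl ler_pdivlMr // natr1 ltW.
- apply: (@measure_cover_le _ _ (fun k => 16 * eta * C1 / w ^+ 3 * rho ^+ k)).
  + by move=> k; have [] := AP k.
  + by move=> k; have [] := AP k.
  + move=> n; rewrite -mulr_sumr.
    apply: (@le_trans _ _ (16 * eta * C1 / w ^+ 3 * (2 * w)^-1)).
      apply: ler_wpM2l; first by rewrite ltW // divr_gt0 ?exprn_gt0 // mulr_gt0 // mulr_gt0.
      by rewrite w2 geometric_partial_le.
    rewrite le_eqVlt; apply/orP; left; apply/eqP; rewrite /eta.
    by field; rewrite !gt_eqF.
Qed.

(** * Transversal lines and tangent lines along a curve *)

(** The tangents are parametrised by their own slopes, for which linear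
separation of the coefficients is trivial; cutting into countably many pieces
bounds the slopes and localises them. *)
Lemma tangent_slopes_negligible (R : realType) (L : set (R * R)) (D : set R) (f f' : R -> R) :
  (hausdorff_dim (union_of_lines L) < 2%:E)%E ->
  (@lebesgue_measure R).-negligible
    [set f' x | x in [set x | D x /\ L (f' x, f x - f' x * x)]].
Proof.
move=> dimL; set T := image _ _.
pose X k j := [set y | T y /\ `|y| <= k%:R /\ j%:R <= y + k%:R < j%:R + 1].
have sub : T `<=` \bigcup_k \bigcup_j X k j;
  last apply: (@negligibleS _ (measurableTypeR R) R lebesgue_measure _ _ sub).
  move=> y Ty; exists (Num.bound `|y|) => //.
  have yk : `|y| <= (Num.bound `|y|)%:R by rewrite ltW // archi_boundP.
  exists (Num.truncn (y + (Num.bound `|y|)%:R)) => //; split=> //; split=> //.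
  rewrite natr1 truncn_itv //.
  by move: yk; rewrite ler_norml => /andP[]; lra.
apply: negligible_bigcup => k; apply: negligible_bigcup => j.
have [l lP] : exists l : R -> R * R, forall y, T y -> L (l y) /\ (l y).1 = y.
  have H y : exists ab : R * R, T y -> L ab /\ ab.1 = y.
    have [Ty|nTy] := pselect (T y); last by exists (0, 0).
    by case: Ty => x [Dx Lx] <-; exists (f' x, f x - f' x * x).
  by have [l lP] := choice H; exists l.
apply: (@expanding_slopes_negligible R L _ (j%:R - k%:R) k%:R 1 l) => //.
  move=> y [Ty [yk /andP[y1 y2]]]; have [Ly lE] := lP y Ty.
  by split=> //; [apply/andP; split; lra|rewrite lE].
move=> x y [Tx _] [Ty _]; have [_ ->] := lP x Tx; have [_ ->] := lP y Ty.
by rewrite mul1r lerDl.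
Qed.

(** The set is cut into countably many pieces on which the slopes are bounded,
the slope of the line differs from [f' x] by at least [2 / k.+1%:R], the linear
approximation of [f] has error at most [k.+1%:R^-1 * `|y - x|] within distance
[m.+1%:R^-1], and the points are that close together.  For two points x and y
of a piece, the difference of the two lines at y is the difference between
[f y] and the line of x, which is at least [k.+1%:R^-1 * `|y - x|]. *)
Lemma transversal_points_negligible (R : realType) (L : set (R * R)) (f f' : R -> R) :
  (hausdorff_dim (union_of_lines L) < 2%:E)%E ->
  (forall x, x \in `[0, 1] ->
     (fun y => (f y - f x) / (y - x)) @ within `[0, 1] x^' --> f' x) ->
  (@lebesgue_measure R).-negligible
    [set x | x \in `[0, 1] /\ exists l, [/\ L l, f x = l.1 * x + l.2 & l.1 != f' x]].
Proof.
move=> dimL df; set T := [set x | _].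
have [l lP] : exists l : R -> R * R, forall x, T x ->
    [/\ x \in `[0, 1], L (l x), f x = (l x).1 * x + (l x).2 & (l x).1 != f' x].
  have H x : exists l : R * R, T x ->
    [/\ x \in `[0, 1], L l, f x = l.1 * x + l.2 & l.1 != f' x].
    have [Tx|nTx] := pselect (T x); last by exists (0, 0).
    by case: Tx => x01 [ab [h1 h2 h3]]; exists ab.
  by have [l lP] := choice H; exists l.
pose X k m j := [set x | [/\ T x, `|(l x).1| <= k%:R,
  2 / k.+1%:R <= `|(l x).1 - f' x|,
  (forall y, y \in `[0, 1] -> `|y - x| < m.+1%:R^-1 ->
    `|f y - f x - f' x * (y - x)| <= k.+1%:R^-1 * `|y - x|) &
  j%:R <= x * m.+1%:R < j%:R + 1]].
have sub : T `<=` \bigcup_k \bigcup_m \bigcup_j X k m j;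
  last apply: (@negligibleS _ (measurableTypeR R) R lebesgue_measure _ _ sub).
  move=> x Tx; have [x01 Lx fx lx] := lP x Tx.
  have x0 : 0 <= x by move: x01; rewrite in_itv /= => /andP[].
  have d0 : 0 < `|(l x).1 - f' x| by rewrite normr_gt0 subr_eq0.
  pose k := maxn (Num.bound `|(l x).1|) (Num.bound (2 / `|(l x).1 - f' x|)).
  exists k => //.
  have k0 : 0 < k.+1%:R^-1 :> R by rewrite invr_gt0.
  have /cvgrPdist_le /(_ _ k0) := df x x01.
  move=> [/= e e0 eP].
  pose m := Num.bound e^-1.
  exists m => //; exists (Num.truncn (x * m.+1%:R)) => //; split=> //.
  - by apply/ltW/(lt_le_trans (archi_boundP _)); rewrite ?ler_nat ?leq_maxl.
  - rewrite ler_pdivrMr // mulrC -ler_pdivrMr //.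
    apply/ltW/(lt_le_trans (archi_boundP _)); first exact: divr_ge0.
    by rewrite ler_nat leqW // leq_maxr.
  - move=> y y01 yx.
    have [->|yx0] := eqVneq y x; first by rewrite !subrr mulr0 subr0 normr0 mulr0.
    have ye : ball x e y.
      rewrite /ball /= distrC; apply: lt_le_trans yx _.
      rewrite -[leRHS]invrK lef_pV2 ?posrE ?invr_gt0 //; apply/ltW.
      apply: lt_le_trans (archi_boundP _) _; first by rewrite invr_ge0 ltW.
      by rewrite ler_nat.
    have := eP y ye yx0 y01.
    have yx' : y - x != 0 by rewrite subr_eq0.
    rewrite -(ler_pM2r (_ : 0 < `|y - x|)) ?normr_gt0 // -normrM.
    by rewrite mulrBl divfK // distrC.
  - by rewrite natr1 truncn_itv // mulr_ge0.
apply: negligible_bigcup => k; apply: negligible_bigcup => m; apply: negligible_bigcup => j.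
apply: (@expanding_slopes_negligible R L _ (j%:R / m.+1%:R) k%:R (k.+1%:R^-1) l) => //.
  move=> x [Tx lk _ _ /andP[x1 x2]]; have [_ Lx _ _] := lP x Tx; split=> //.
  rewrite ler_pdivrMr // x1 /=.
  have m0 : (0 : R) < m.+1%:R by [].
  rewrite -(ltr_pM2r m0) mulrDl divfK ?gt_eqF // mul1r (lt_le_trans x2) // lerD2l.
  by rewrite ler1n.
move=> x y [Tx _ lx dx /andP[x1 x2]] [Ty _ _ _ /andP[y1 y2]].
have [x01 _ fx _] := lP x Tx; have [y01 _ fy _] := lP y Ty.
have xy : `|y - x| < m.+1%:R^-1.
  rewrite -[ltRHS]mul1r ltr_pdivlMr // -[X in _ * X]ger0_norm // -normrM ltr_norml mulrBl.
  apply/andP; split; lra.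
have err := dx y y01 xy.
have yle : `|y| <= 1 by move: y01; rewrite in_itv /= => /andP[y0 y1']; rewrite ger0_norm.
have key : ((l y).1 - (l x).1) * y + ((l y).2 - (l x).2) =
    (f y - f x - f' x * (y - x)) - ((l x).1 - f' x) * (y - x).
  by rewrite fx fy; ring.
have h1 : `|((l x).1 - f' x) * (y - x)| <=
    `|((l y).1 - (l x).1) * y + ((l y).2 - (l x).2)| + k.+1%:R^-1 * `|y - x|.
  rewrite (_ : _ * (y - x) = (f y - f x - f' x * (y - x)) -
     (((l y).1 - (l x).1) * y + ((l y).2 - (l x).2))); last by rewrite key; ring.
  by apply: le_trans (ler_normB _ _) _; rewrite addrC lerD2l.
have h2 : `|((l y).1 - (l x).1) * y + ((l y).2 - (l x).2)| <=
   `|(l x).1 - (l y).1| + `|(l x).2 - (l y).2|.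
  apply: le_trans (ler_normD _ _) _; rewrite (distrC (l x).1) (distrC (l x).2) lerD2r normrM.
  by rewrite ler_piMr.
rewrite normrM in h1.
have := ler_wpM2r (normr_ge0 (y - x)) lx.
rewrite [`|x - y|]distrC -mulrA; move: h1 h2.
set p := _ * `|y - x|; set q := k.+1%:R^-1 * _; lra.
Qed.

(** * Level sets of a difference of two distribution functions *)

(** [mu] is the Stieltjes measure of [F], tested on open intervals only, so
that jumps of [F] are excluded. *)
Definition open_itv_increments {R : realType}
    (mu : set (measurableTypeR R) -> \bar R) (F : R -> R) : Prop :=
  forall a b, a <= b -> mu `]a, b[%classic = (F b - F a)%:E.

(** An end of a component that belonged to the open set would lie in another
component, which would then overlap this one. *)
Lemma component_endpoints (R : realType) (U : set R) (oU : open U) (p q : R) (i : nat) :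
  (U `<=` `]p, q[%classic) -> open_disjoint_itv oU i = set0 \/
  exists u v, [/\ p <= u, u < v & v <= q] /\ [/\ ~ U u, ~ U v &
     open_disjoint_itv oU i = `]u, v[%classic].
Proof.
move=> Upq; set I := open_disjoint_itv oU.
have [->|/set0P[x0 Ix0]] := eqVneq (I i) set0; [by left|right].
have IU j : I j `<=` U.
  by move=> x Ix; rewrite (open_disjoint_itv_bigcup oU); exists j.
have oI j : open (I j) by exact: open_disjoint_itv_open.
have lI : has_lbound (I i).
  by exists p => x /IU /Upq; rewrite /= in_itv /= => /andP[/ltW].
have uI : has_ubound (I i).
  by exists q => x /IU /Upq; rewrite /= in_itv /= => /andP[_ /ltW].
have IE : I i = `]inf (I i), sup (I i)[%classic.
  have h := interval_bounded_interior (@open_disjoint_itv_is_interval _ _ oU i) lI uI.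
  rewrite ((interior_id _).1 (oI i)) in h; rewrite [LHS]h.
  by apply/seteqP; split => x /=; rewrite in_itv.
set u := inf (I i) in IE *; set v := sup (I i) in IE *.
have /andP[ux0 x0v] : u < x0 < v by move: Ix0; rewrite IE /= in_itv.
have uv : u < v by exact: lt_trans x0v.
have disj j x : I i x -> I j x -> i = j.
  move=> Iix Ijx; apply: (@open_disjoint_itv_trivIset _ _ oU i j) => //.
  by exists x; split.
exists u, v; split; split => //.
- apply: lb_le_inf; first by exists x0.
  by move=> x /IU /Upq; rewrite /= in_itv /= => /andP[/ltW].
- apply: ge_sup; first by exists x0.
  by move=> x /IU /Upq; rewrite /= in_itv /= => /andP[_ /ltW].
- rewrite (open_disjoint_itv_bigcup oU) => -[j _ Iju].
  have [x Ijx /andP[ux xv]] : exists2 x, I j x & u < x < v.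
    near u^'+ => x; exists x.
      by near: x; apply: cvg_within; exact: open_nbhs_nbhs.
    by apply/andP; split; near: x; [exact: nbhs_right_gt|exact: nbhs_right_lt].
  have E : i = j by apply: (disj j x) => //; rewrite IE /= in_itv /= ux.
  by move: Iju; rewrite -E -/(I i) IE /= in_itv /= ltxx.
- rewrite (open_disjoint_itv_bigcup oU) => -[j _ Ijv].
  have [x Ijx /andP[ux xv]] : exists2 x, I j x & u < x < v.
    near v^'- => x; exists x.
      by near: x; apply: cvg_within; exact: open_nbhs_nbhs.
    by apply/andP; split; near: x; [exact: nbhs_left_gt|exact: nbhs_left_lt].
  have E : i = j by apply: (disj j x) => //; rewrite IE /= in_itv /= ux.
  by move: Ijv; rewrite -E -/(I i) IE /= in_itv /= ltxx andbF.
Unshelve. all: by end_near.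
Qed.

(** On each component of the open set the function [F1 - F2] takes the value
[c] at both ends, so that both measures give it the same mass. *)
Lemma above_level_eq (R : realType) (m1 m2 : {measure set (measurableTypeR R) -> \bar R})
    (F1 F2 : R -> R) (p q c : R) :
  open_itv_increments m1 F1 -> open_itv_increments m2 F2 ->
  continuous (fun x => F1 x - F2 x) ->
  F1 p - F2 p <= c -> F1 q - F2 q <= c ->
  m1 (`]p, q[%classic `&` [set x | c < F1 x - F2 x]) =
  m2 (`]p, q[%classic `&` [set x | c < F1 x - F2 x]).
Proof.
move=> h1 h2 cG Gp Gq; set U := _ `&` _.
have oU : open U.
  apply: openI; first exact: interval_open.
  have /continuousP cGo := cG; exact: (cGo [set y | c < y] (@open_gt _ c)).
have oI i : open (open_disjoint_itv oU i) by exact: open_disjoint_itv_open.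
have mI i : measurable (open_disjoint_itv oU i : set (measurableTypeR R)).
  exact: open_measurable.
have tI := @open_disjoint_itv_trivIset _ _ oU.
have mU : measurable (\bigcup_i open_disjoint_itv oU i : set (measurableTypeR R)).
  exact: bigcupT_measurable.
rewrite [X in m1 X](open_disjoint_itv_bigcup oU) [X in m2 X](open_disjoint_itv_bigcup oU).
rewrite (measure_semi_bigcup _ mI tI mU) (measure_semi_bigcup _ mI tI mU).
apply: eq_eseriesr => i _.
have Upq : U `<=` `]p, q[%classic by move=> x [].
have [IE|[u [v [[pu uv vq] [nUu nUv IE]]]]] := component_endpoints R U oU p q i Upq.
  by rewrite IE !measure0.
rewrite IE (h1 _ _ (ltW uv)) (h2 _ _ (ltW uv)); congr EFin.
have IU x : u < x < v -> c <= F1 x - F2 x.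
  move=> uxv; have : U x.
    by rewrite (open_disjoint_itv_bigcup oU); exists i => //; rewrite IE /= in_itv.
  by case=> _ /ltW.
have Gu : F1 u - F2 u = c.
  apply/eqP; rewrite eq_le; apply/andP; split.
    have [<-//|pu'] := eqVneq p u.
    rewrite leNgt; apply/negP => cu; apply: nUu; split => //=.
    by rewrite in_itv /= lt_neqAle pu' pu (lt_le_trans uv vq).
  apply: (@cvgr_to_ge _ _ _ _ (fun x => F1 x - F2 x) _ c (cvg_at_right_filter (cG u))).
  near=> x; apply: IU; apply/andP; split; near: x; first exact: nbhs_right_gt.
  exact: nbhs_right_lt.
have Gv : F1 v - F2 v = c.
  apply/eqP; rewrite eq_le; apply/andP; split.
    have [->//|vq'] := eqVneq v q.
    rewrite leNgt; apply/negP => cv; apply: nUv; split => //=.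
    by rewrite in_itv /= (le_lt_trans pu uv) lt_neqAle vq'.
  apply: (@cvgr_to_ge _ _ _ _ (fun x => F1 x - F2 x) _ c (cvg_at_left_filter (cG v))).
  near=> x; apply: IU; apply/andP; split; near: x; last exact: nbhs_left_lt.
  exact: nbhs_left_gt.
lra.
Unshelve. all: by end_near.
Qed.

Lemma last_time_below (R : realType) (G : R -> R) (p q c : R) :
  continuous G -> p < q -> G p <= c -> c < G q ->
  exists r, [/\ p <= r, r < q, G r = c & forall x, r < x -> x <= q -> c < G x].
Proof.
move=> cG pq Gp Gq; pose S := [set x | p <= x <= q /\ G x <= c].
have Sp : S p by split => //; rewrite lexx ltW.
have hS : has_sup S by split; [exists p|exists q => x [/andP[]]].
pose r := sup S.
have pr : p <= r by apply: ub_le_sup => //; exact: hS.2.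
have rq : r <= q by apply: ge_sup; [exists p|move=> x [/andP[]]].
have above x : r < x -> x <= q -> c < G x.
  move=> rx xq; rewrite ltNge; apply/negP => Gx.
  have : x <= r by apply: ub_le_sup; [exact: hS.2|split => //; rewrite xq (le_trans pr) ?ltW].
  by rewrite leNgt rx.
have Grc : G r <= c.
  rewrite leNgt; apply/negP => cGr.
  have : \forall x \near r, c < G x by exact: cvgr_gt (cG r) _ cGr.
  move=> [e /= e0 eP].
  have [x Sx xe] := sup_adherent e0 hS.
  have xr : x <= r by apply: ub_le_sup => //; exact: hS.2.
  have : c < G x by apply: eP; rewrite /ball /= ger0_norm ?subr_ge0 // ltrBlDl -ltrBlDr.
  by case: Sx => _; rewrite leNgt => /negP.
have rq' : r < q.
  by rewrite lt_neqAle rq andbT; apply/negP => /eqP rE; move: Grc; rewrite rE leNgt Gq.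
exists r; split => //; apply/eqP; rewrite eq_le Grc /=.
apply: (@cvgr_to_ge _ _ _ _ G _ c (cvg_at_right_filter (cG r))).
near=> x; apply/ltW/above; near: x; first exact: nbhs_right_gt.
exact: nbhs_right_le.
Unshelve. all: by end_near.
Qed.

Section level.
Variables (R : realType) (m1 m2 : {measure set (measurableTypeR R) -> \bar R}).
Variables (F1 F2 : R -> R) (p q : R).
Hypotheses (h1 : open_itv_increments m1 F1) (h2 : open_itv_increments m2 F2).
Hypothesis cG : continuous (fun x => F1 x - F2 x).
Hypothesis pq : p < q.
Let G x := F1 x - F2 x.
Let J : set (measurableTypeR R) := `]p, q[%classic.

Let mG (A : set R) : measurable A -> measurable (G @^-1` A : set (measurableTypeR R)).
Proof.
move=> mA; rewrite -[X in measurable X]setTI.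
exact: (continuous_measurable_fun cG).
Qed.

Let mJ : measurable J.
Proof. exact: measurable_itv. Qed.

Let JfinE (m : {measure set (measurableTypeR R) -> \bar R}) F A :
  open_itv_increments m F -> measurable A -> A `<=` J -> (m A < +oo)%E.
Proof.
move=> h mA AJ; apply: (@le_lt_trans _ _ (m J)); first by apply: le_measure; rewrite ?inE.
by rewrite h ?ltry // ltW.
Qed.

Let mGc c : measurable ([set x | c < G x] : set (measurableTypeR R)).
Proof.
have -> : [set x | c < G x] = G @^-1` `]c, +oo[.
  by apply/seteqP; split => x /=; rewrite in_itv /= andbT.
by apply: mG; exact: measurable_itv.
Qed.

Let mGc' c : measurable ([set x | G x <= c] : set (measurableTypeR R)).
Proof.
have -> : [set x | G x <= c] = G @^-1` `]-oo, c].
  by apply/seteqP; split => x /=; rewrite in_itv.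
by apply: mG; exact: measurable_itv.
Qed.

(** The closed condition [G x <= c] is the decreasing limit of the open ones
[G x < c + e / n.+1%:R], to which [above_level_eq] applies after a change of
sign. *)
Lemma below_level_eq (c : R) : c < G p -> c < G q ->
  m1 (J `&` [set x | G x <= c]) = m2 (J `&` [set x | G x <= c]).
Proof.
move=> cp cq.
(* small enough for the levels c + e / n.+1 to stay below both end values *)
pose e := Num.min (G p - c) (G q - c).
have e0 : 0 < e by rewrite lt_min !subr_gt0 cp cq.
pose A n := J `&` [set x | G x < c + e / n.+1%:R].
have eA n : m1 (A n) = m2 (A n).
  have -> : A n = `]p, q[ `&` [set x | - (c + e / n.+1%:R) < F2 x - F1 x].
    by apply/seteqP; split => x /= [Jx h]; split => //; move: h;
      rewrite -[F2 x - F1 x]opprB ltrN2.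
  apply/esym/above_level_eq => //.
  - move=> x; have -> : (fun x => F2 x - F1 x) = (fun x => - G x).
      by apply/funext => y; rewrite /G opprB.
    exact: (cvgN (cG x)).
  - have : e / n.+1%:R <= e by rewrite ler_pdivrMr // ler_peMr ?(ltW e0) // ler1n.
    have : e <= G p - c by rewrite ge_min lexx.
    by rewrite /G; set u := e / _; set v := e; lra.
  - have : e / n.+1%:R <= e by rewrite ler_pdivrMr // ler_peMr ?(ltW e0) // ler1n.
    have : e <= G q - c by rewrite ge_min lexx orbT.
    by rewrite /G; set u := e / _; set v := e; lra.
have mA n : measurable (A n).
  by apply: measurableI => //; apply: (mG `]-oo, (c + e / n.+1%:R)[%classic); exact: measurable_itv.
have IE : J `&` [set x | G x <= c] = \bigcap_n A n.
  apply/seteqP; split => x /=.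
    move=> [Jx Gx] n _; split => //=; apply: le_lt_trans Gx _.
    by rewrite ltrDl divr_gt0.
  move=> h; split; first by case: (h 0%N Logic.I).
  rewrite leNgt; apply/negP => cx.
  have [_ /=] := h (Num.bound (e / (G x - c))) Logic.I.
  apply/negP; rewrite -leNgt -lerBrDl ler_pdivrMr // mulrC -ler_pdivrMr ?subr_gt0 //.
  apply/ltW/(lt_le_trans (archi_boundP _)).
    by rewrite divr_ge0 ?ltW // subr_gt0.
  by rewrite ler_nat.
have ni : nonincreasing_seq A.
  move=> m n mn; apply/subsetPset => x [Jx /= Gx]; split => //=.
  apply: lt_le_trans Gx _; rewrite lerD2l ler_pM2l // lef_pV2 ?posrE //.
  by rewrite ler_nat.
have mI : measurable (\bigcap_n A n) by exact: bigcapT_measurable.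
have AJ n : A n `<=` J by move=> x [].
rewrite IE.
have c1 := nonincreasing_cvg_mu (JfinE _ _ _ h1 (mA 0%N) (@AJ 0%N)) mA mI ni.
have c2 := nonincreasing_cvg_mu (JfinE _ _ _ h2 (mA 0%N) (@AJ 0%N)) mA mI ni.
rewrite -(cvg_lim _ c1) // -(cvg_lim _ c2) //.
by congr (lim (_ @ \oo)); apply/funext => n; exact: eA.
Qed.

(** If [c] lies between the two end values, the last time at which [G] is at
most [c] splits the interval into a part with both end values at most [c] and a
part entirely above [c].  If [c] is smaller than both end values, the
complement is handled by [below_level_eq]. *)
Lemma level_pushforward (c : R) : G p <= G q ->
  m1 (J `&` [set x | c < G x]) =
  (m2 (J `&` [set x | (c < G x)%R]) + lebesgue_measure (`]G p, G q] `&` `]c, +oo[))%E.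
Proof.
move=> Gpq.
have [Gqc|cGq] := leP (G q) c.
  rewrite (_ : (`]G p, G q] `&` `]c, +oo[)%classic = set0) ?measure0 ?adde0; last first.
    apply/seteqP; split => x //= []; rewrite !in_itv /= andbT => /andP[_ xq] cx; lra.
  by apply: above_level_eq => //; exact: le_trans Gpq Gqc.
have [Gpc|cGp] := leP (G p) c.
  have -> : `]G p, G q] `&` `]c, +oo[ = `]c, G q]%classic.
    apply/seteqP; split => x /=; rewrite !in_itv /= andbT.
      by move=> [/andP[_ ->] ->].
    by move=> /andP[cx ->]; rewrite cx (le_lt_trans Gpc cx).
  rewrite lebesgue_measure_itv /= lte_fin cGq -EFinD.
  have [r [pr rq Gr rP]] := last_time_below R G p q c cG pq Gpc cGq.
  have split12 : J `&` [set x | c < G x] =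
      (`]p, r[ `&` [set x | c < G x]) `|` `]r, q[.
    apply/seteqP; split => x /=.
      rewrite /J /= !in_itv /= => -[/andP[px xq] cx].
      have [xr|rx|xr] := ltgtP x r.
      - by left; rewrite px.
      - by right; rewrite xq.
      - by move: cx; rewrite xr -/(G r) in Gr *; rewrite Gr ltxx.
    rewrite /J /= !in_itv /= => -[[/andP[px xr] cx]|/andP[rx xq]].
      by rewrite px (lt_trans xr rq).
    by rewrite (le_lt_trans pr rx) xq; split => //; apply: rP => //; exact: ltW.
  have mU (m : {measure set (measurableTypeR R) -> \bar R}) :
     m (J `&` [set x | c < G x]) =
     (m (`]p, r[%classic `&` [set x | (c < G x)%R]) + m `]r, q[%classic)%E.
    rewrite split12 measureU //.
    - by apply: measurableI; [exact: measurable_itv|exact: mGc].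
    - apply/seteqP; split => x //= [[]]; rewrite !in_itv /= => /andP[_ xr] _ /andP[rx _].
      by have := lt_trans rx xr; rewrite ltxx.
  have Grc : F1 r - F2 r <= c by rewrite -/(G r) Gr.
  rewrite !mU (above_level_eq _ _ _ _ _ _ _ _ h1 h2 cG Gpc Grc).
  rewrite (h1 _ _ (ltW rq)) (h2 _ _ (ltW rq)) -addeA -EFinD; congr (_ + _%:E)%E.
  by rewrite -Gr /G; ring.
have -> : `]G p, G q] `&` `]c, +oo[ = `]G p, G q]%classic.
  apply/seteqP; split => x /=; rewrite !in_itv /= andbT; first by case.
  by move=> /andP[h ->]; rewrite h (lt_trans cGp h).
rewrite lebesgue_measure_itv /=.
have mU (m : {measure set (measurableTypeR R) -> \bar R}) :
    m J = (m (J `&` [set x | (G x <= c)%R]) + m (J `&` [set x | (c < G x)%R]))%E.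
  rewrite -measureU; last 3 first.
  - by apply: measurableI => //; exact: mGc'.
  - by apply: measurableI => //; exact: mGc.
  - by apply/seteqP; split => x //= [[_ xc] [_]]; rewrite ltNge xc.
  congr (m _); apply/seteqP; split => x /=; last by case=> -[].
  by move=> Jx; have [xc|xc] := leP (G x) c; [left|right].
have := mU m1; have := mU m2; rewrite (h1 _ _ (ltW pq)) (h2 _ _ (ltW pq)).
have J1 : J `&` [set x | G x <= c] `<=` J by move=> x [].
have J2 : J `&` [set x | c < G x] `<=` J by move=> x [].
have mJ1 : measurable (J `&` [set x | G x <= c]) by apply: measurableI => //; exact: mGc'.
have mJ2 : measurable (J `&` [set x | c < G x]) by apply: measurableI => //; exact: mGc.
rewrite (below_level_eq _ cGp (lt_le_trans cGp Gpq)).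
have := JfinE _ _ _ h1 mJ2 J2; have := JfinE _ _ _ h2 mJ2 J2; have := JfinE _ _ _ h2 mJ1 J1.
rewrite -!ge0_fin_numE //.
move=> /fineK <- /fineK <- /fineK <-.
rewrite -!EFinD => -[e2] [e1].
rewrite lte_fin; case: ifPn => [_|].
  by rewrite -!EFinD; congr EFin; rewrite /G; lra.
rewrite -leNgt => Gqp; rewrite adde0; congr EFin.
have : G p = G q by apply/eqP; rewrite eq_le Gpq.
by rewrite /G; lra.
Qed.
End level.

(** * Borel sets with null image *)

Lemma restricted_image_measure (R : realType) (m : {measure set (measurableTypeR R) -> \bar R})
    (D : set (measurableTypeR R)) (G : measurableTypeR R -> measurableTypeR R) :
  measurable D -> measurable_fun setT G ->
  exists M : {measure set (measurableTypeR R) -> \bar R},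
    forall A, M A = m (G @^-1` A `&` D).
Proof.
move=> mD mG; unshelve eexists (pushforward (mrestr m mD) G); first exact: mG.
by [].
Qed.

(** Half-lines determine finite Borel measures, so [level_pushforward]
identifies the image of the signed measure on ]p, q[ with the Lebesgue measure
on the interval between the end values. *)
Lemma null_preimage_itv (R : realType) (m1 m2 : {measure set (measurableTypeR R) -> \bar R})
    (F1 F2 : R -> R) (p q : R) (Z : set (measurableTypeR R)) :
  open_itv_increments m1 F1 -> open_itv_increments m2 F2 ->
  continuous (fun x => F1 x - F2 x) -> p < q -> F1 p - F2 p <= F1 q - F2 q ->
  measurable Z -> lebesgue_measure Z = 0%E ->
  m1 (`]p, q[%classic `&` [set x | Z (F1 x - F2 x)]) =
  m2 (`]p, q[%classic `&` [set x | Z (F1 x - F2 x)]).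
Proof.
move=> h1 h2 cG pq Gpq mZ Z0; pose G (x : measurableTypeR R) : measurableTypeR R := F1 x - F2 x.
have mG : measurable_fun setT G by exact: continuous_measurable_fun.
have mJ : measurable (`]p, q[%classic : set (measurableTypeR R)) by exact: measurable_itv.
have mK : measurable (`]G p, G q]%classic : set (measurableTypeR R)) by exact: measurable_itv.
have [M1 M1E] := restricted_image_measure R m1 _ _ mJ mG.
have [M2 M2E] := restricted_image_measure R m2 _ _ mJ mG.
pose M3 : {measure set (measurableTypeR R) -> \bar R} := mrestr (@lebesgue_measure R) mK.
have E (A : set (measurableTypeR R)) : measurable A -> M1 A = measure_add M2 M3 A.
  apply: (@measure_unique _ R (measurableTypeR R) (@RGenOInfty.G R)
    (fun k => `]- k%:R, +oo[%classic) _ _ _ _ M1 (measure_add M2 M3)).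
  - exact: RGenOInfty.measurableE.
  - move=> A1 A2 [x ->] [y ->]; exists (Num.max x y).
    by apply/seteqP; split => z /=; rewrite !in_itv /= !andbT gt_max; [case=> -> ->|move=> /andP[]].
  - by move=> k; exists (- k%:R).
  - rewrite -subTset => x _; exists (Num.bound `|x|) => //=.
    have := archi_boundP (normr_ge0 x); rewrite in_itv /= andbT ltr_norml.
    by case/andP.
  - move=> B [c ->]; apply: (etrans _ (esym (measure_addE M2 M3 _))).
    rewrite M1E M2E /M3 /= /mrestr.
    have := @level_pushforward R m1 m2 F1 F2 p q h1 h2 cG pq c Gpq.
    have -> : G @^-1` `]c, +oo[ = [set x | c < F1 x - F2 x].
      by apply/seteqP; split => x /=; rewrite in_itv /= andbT.
    by rewrite !(setIC `]p, q[%classic) (setIC `]_, _]%classic).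
  - move=> k; rewrite M1E; apply: (@le_lt_trans _ _ (m1 `]p, q[%classic)).
      apply: le_measure; rewrite ?inE //; apply: measurableI => //.
      by rewrite -[X in measurable X]setTI; apply: mG => //; exact: measurable_itv.
    by rewrite h1 ?ltry // ltW.
have := E Z mZ.
rewrite measure_addE M1E M2E /M3 /= /mrestr.
have -> : lebesgue_measure (Z `&` `]G p, G q]%classic) = 0%E.
  by apply: (@subset_measure0 _ _ _ lebesgue_measure _ Z) => //; exact: measurableI.
by rewrite adde0 !(setIC `]p, q[%classic).
Qed.

(** The two measures agree on the traces of all intervals on the preimage of a
null set, hence on all its Borel subsets. *)
Lemma null_image_increments_eq (R : realType)
    (m1 m2 : {measure set (measurableTypeR R) -> \bar R})
    (F1 F2 : R -> R) (A : set (measurableTypeR R)) :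
  open_itv_increments m1 F1 -> open_itv_increments m2 F2 ->
  continuous (fun x => F1 x - F2 x) -> measurable A ->
  (@lebesgue_measure R).-negligible [set F1 x - F2 x | x in A] ->
  m1 A = m2 A.
Proof.
move=> h1 h2 cG mA [Z [mZ Z0 AZ]].
pose G (x : measurableTypeR R) : measurableTypeR R := F1 x - F2 x.
have mG : measurable_fun setT G by exact: continuous_measurable_fun.
pose B := G @^-1` Z.
have mB : measurable B by rewrite -[X in measurable X]setTI; exact: mG.
have -> : A = A `&` B by rewrite setIidl // => x Ax; apply: AZ; exists x.
have JB p q : m1 (`]p, q[%classic `&` B) = m2 (`]p, q[%classic `&` B).
  have [pq|qp] := ltP p q; last by rewrite set_itv_ge ?set0I ?measure0 // -leNgt.
  have [Gpq|Gqp] := leP (F1 p - F2 p) (F1 q - F2 q); first exact: null_preimage_itv.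
  have mN : measurable ((-%R : measurableTypeR R -> measurableTypeR R) @^-1` Z).
    by rewrite -[X in measurable X]setTI; exact: oppr_measurable.
  have N0 : lebesgue_measure ((-%R : measurableTypeR R -> measurableTypeR R) @^-1` Z) = 0%E.
    by rewrite -Z0; exact: lebesgue_measureN.
  have cN : continuous (fun x => F2 x - F1 x).
    move=> x; rewrite (_ : (fun x => F2 x - F1 x) = (fun x => - (F1 x - F2 x))).
      exact: (cvgN (cG x)).
    by apply/funext => y; rewrite opprB.
  have G21 : F2 p - F1 p <= F2 q - F1 q by move: Gqp; lra.
  have := @null_preimage_itv R m2 m1 F2 F1 p q _ h2 h1 cN pq G21 mN N0.
  have -> : [set x | (-%R @^-1` Z) (F2 x - F1 x)] = B.
    by apply/seteqP; split => x /=; rewrite opprB.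
  by move=> ->.
have E : mrestr m1 mB A = mrestr m2 mB A; last exact: E.
apply: (@measure_unique _ R (measurableTypeR R) (@RGenOpens.G R)
  (fun k => `]- k%:R, k%:R[%classic) _ _ _ _ (mrestr m1 mB) (mrestr m2 mB)) => //.
- exact: RGenOpens.measurableE.
- move=> A1 A2 [x [y ->]] [x' [y' ->]]; exists (Num.max x x'), (Num.min y y').
  apply/seteqP; split => z /=; rewrite !in_itv /= gt_max lt_min.
    by case=> /andP[-> ->] /andP[-> ->].
  by move=> /andP[/andP[-> ->] /andP[-> ->]].
- by move=> k; exists (- k%:R), k%:R.
- rewrite -subTset => x _; exists (Num.bound `|x|) => //=.
  by have := archi_boundP (normr_ge0 x); rewrite in_itv /= ltr_norml.
- by move=> C [p [q ->]]; exact: JB.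
- move=> k; apply: (@le_lt_trans _ _ (m1 `]- k%:R, k%:R[%classic)).
    have mk : measurable (`]- k%:R, k%:R[%classic : set (measurableTypeR R)).
      exact: measurable_itv.
    by apply: le_measure => //; rewrite inE //; exact: measurableI.
  by rewrite h1 ?ltry // -subr_ge0 opprK addr_ge0.
Qed.

(** * Integration by parts *)

Lemma integral_derivative_itv (R : realType) (phi psi : R -> R) (a b : R) :
  (forall x : R, is_derive x (1 : R) phi (psi x)) -> continuous psi -> a <= b ->
  (\int[@lebesgue_measure R]_(t in `]a, b[) (psi t)%:E = (phi b - phi a)%:E)%E.
Proof.
move=> dphi cpsi; rewrite le_eqVlt => /predU1P[->|ab].
  by rewrite set_itv_ge ?integral_set0 ?subrr // bnd_simp ltxx.
have mpsi (A : set R) : measurable_fun A (fun t => (psi t)%:E).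
  apply/measurable_EFinP; apply: measurable_funTS; exact: continuous_measurable_fun.
have cphi : continuous phi.
  by move=> x; apply/differentiable_continuous/derivable1_diffP; have [] := dphi x.
rewrite integral_itv_bndo_bndc //= integral_itv_obnd_cbnd //=.
rewrite (@continuous_FTC2 _ psi phi) //.
- exact: continuous_subspaceT.
- split; [by move=> x _; have [] := dphi x| |].
  + exact: cvg_at_right_filter (cphi a).
  + exact: cvg_at_left_filter (cphi b).
- by move=> x _; rewrite derive1E; apply: derive_val.
Qed.

(** Fubini's theorem for the function psi t on the triangle 0 < t < x < 1:
integrating in t first gives phi x, and integrating in x first gives psi t
times the mass of ]t, 1[. *)
Lemma stieltjes_by_parts (R : realType)
    (mu : {sigma_finite_measure set (measurableTypeR R) -> \bar R})
    (C phi psi : R -> R) :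
  open_itv_increments mu C -> 
  (forall x : R, is_derive x (1 : R) phi (psi x)) -> continuous psi -> phi 0 = 0 ->
  (\int[mu]_(x in `]0%R, 1%R[) (phi x)%:E =
   \int[@lebesgue_measure R]_(t in `]0%R, 1%R[) (psi t * (C 1 - C t))%:E)%E.
Proof.
move=> muC dphi cpsi phi0.
pose D : set (measurableTypeR R) := `]0%R, 1%R[%classic.
have mD : measurable D by exact: measurable_itv.
pose k (z : measurableTypeR R * measurableTypeR R) : bool :=
  [&& (0 : R) < z.2, (z.2 : R) < z.1 & (z.1 : R) < 1].
pose u (z : measurableTypeR R * measurableTypeR R) : R := if k z then psi z.2 else 0.
have mk : measurable_fun setT k.
  have fstm : measurable_fun setT (fst : measurableTypeR R * measurableTypeR R -> R).
    exact: measurable_fst.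
  have sndm : measurable_fun setT (snd : measurableTypeR R * measurableTypeR R -> R).
    exact: measurable_snd.
  apply: measurable_and; first exact: (measurable_fun_ltr (measurable_cst _) sndm).
  apply: measurable_and; first exact: (measurable_fun_ltr sndm fstm).
  exact: (measurable_fun_ltr fstm (measurable_cst _)).
have mpsi : measurable_fun setT (psi : measurableTypeR R -> R).
  exact: continuous_measurable_fun.
have mu_ : measurable_fun setT u.
  apply: measurable_fun_ifT => //.
  exact: (measurableT_comp mpsi measurable_snd).
have iu : (mu \x (@lebesgue_measure R))%E.-integrable setT (EFin \o u).
  have -> : EFin \o u = (EFin \o u) \_ (D `*` D).
    apply/funext => -[x t]; rewrite patchE; case: ifPn => // /negP; rewrite inE => nD.
    rewrite /u /k /=; case: ifPn => // /and3P[t0 tx x1]; exfalso; apply: nD.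
    by split; rewrite /D /= in_itv /= ?t0 ?(lt_trans t0 tx) ?(lt_trans tx x1) ?x1.
  have mDD : measurable (D `*` D) by apply: measurableX.
  have finDD : ((mu \x (@lebesgue_measure R)) (D `*` D) < +oo)%E.
    have muD : mu D = (C 1 - C 0)%:E by exact: muC.
    rewrite product_measure1E //; apply: lte_mul_pinfty; first exact: measure_ge0.
      by rewrite [X in X \is a _]muD.
    have lD : lebesgue_measure D = (1 : R)%:E.
      by rewrite /D lebesgue_measure_itv /= lte_fin ltr01 oppr0 adde0.
    by rewrite [ltLHS]lD ltry.
  apply/(integrable_mkcond _ mDD).
  apply: measurable_bounded_integrable => //.
  - exact: measurable_funTS.
  - have [c c01 cmax] := @EVT_max R (fun t => `|psi t|) 0 1 ler01
      (continuous_subspaceT (fun x => cvg_norm (cpsi x))).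
    exists `|psi c|; split; first exact: normr_real.
    move=> M cM z _; rewrite /u /=; have [/and3P[z0 zz z1]|_] := boolP (k z); last first.
      by rewrite normr0; apply: le_trans (ltW cM).
    apply: le_trans (ltW cM); apply: cmax.
    by rewrite in_itv /= ltW // ltW // (lt_trans zz).
rewrite [LHS]integral_mkcond [RHS]integral_mkcond.
transitivity (\int[mu]_x \int[@lebesgue_measure R]_t (u (x, t))%:E)%E.
  apply: eq_integral => x _; rewrite patchE; case: ifPn; last first.
    move=> /negP; rewrite inE /= in_itv /= => /negP xD.
    rewrite integral0_eq // => t _; rewrite /u /k /=; case: ifPn => // /and3P[t0 tx x1].
    by move: xD; rewrite x1 (lt_trans t0 tx).
  rewrite inE /= in_itv /= => /andP[x0 x1].
  transitivity (\int[@lebesgue_measure R]_(t in `]0%R, x[) (psi t)%:E)%E.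
    by rewrite (integral_derivative_itv _ _ _ _ _ dphi cpsi (ltW x0)) phi0 subr0.
  rewrite integral_mkcond; apply: eq_integral => t _; rewrite patchE /u /k /=.
  by rewrite x1 andbT mem_setE in_itv /=; case: ifP.
transitivity (\int[@lebesgue_measure R]_t \int[mu]_x (u (x, t))%:E)%E.
  exact: (Fubini iu).
apply: eq_integral => t _; rewrite patchE; case: ifPn; last first.
  move=> /negP; rewrite inE /= in_itv /= => /negP tD.
  rewrite integral0_eq // => x _; rewrite /u /k /=; case: ifPn => // /and3P[t0 tx x1].
  by move: tD; rewrite t0 (lt_trans tx x1).
rewrite inE /= in_itv /= => /andP[t0 t1].
transitivity (\int[mu]_(x in `]t, 1%R[) (cst (psi t)%:E) x)%E.
  rewrite [RHS]integral_mkcond; apply: eq_integral => x _; rewrite patchE /u /k /=.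
  by rewrite t0 mem_setE in_itv /=; case: ifP.
rewrite integral_cst; last exact: measurable_itv.
by rewrite EFinM; congr (_ * _)%E; apply: muC; exact: ltW.
Qed.

(** * Stieltjes measures on the unit interval and their charges *)

(** Composition with [clamp01] extends a function on the unit interval by
constants. *)
Definition clamp01 {R : realType} (x : R) : R := Num.max 0 (Num.min x 1).

Lemma clamp01_itv (R : realType) (x : R) : clamp01 x \in `[0, 1].
Proof. by rewrite in_itv /= /clamp01 le_max lexx /= ge_max ler01 ge_min lexx orbT. Qed.

Lemma clamp01_id (R : realType) (x : R) : x \in `[0, 1] -> clamp01 x = x.
Proof. by rewrite in_itv /= => /andP[x0 x1]; rewrite /clamp01 min_l // max_r. Qed.

Lemma continuous_clamp01 (R : realType) (h : R -> R) :
  {within `[0, 1], continuous h} -> continuous (fun x => h (clamp01 x)).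
Proof.
move=> /subspace_continuousP ch x.
have cc : {for x, continuous (@clamp01 R)}.
  have cst_ (c : R) : {for x, continuous (cst c : R -> R^o)} by exact: cst_continuous.
  have id_ : {for x, continuous (id : R -> R^o)} by exact: cvg_id.
  exact: (continuous_max (cst_ 0) (continuous_min id_ (cst_ 1))).
apply: cvg_trans (ch _ (clamp01_itv _ x)) => A.
rewrite /= => hA; have : nbhs x (clamp01 @^-1` [set y | y \in `[0, 1] -> A (h y)]).
  exact: (cc _ hA).
by apply: filterS => y; apply; exact: clamp01_itv.
Qed.

(** The measure is given on left-open, right-closed intervals; continuity of
[C] makes points null. *)
Lemma lebesgue_stieltjes_open_itv (R : realType) (C : cumulative R R) :
  continuous C -> open_itv_increments (lebesgue_stieltjes_measure C) C.
Proof.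
move=> cC a b ab.
pose mu : {measure set (measurableTypeR R) -> \bar R} := lebesgue_stieltjes_measure C.
change (mu `]a, b[%classic = (C b - C a)%:E).
have ocE x y : x <= y -> mu `]x, y]%classic = (C y - C x)%:E.
  move=> xy; rewrite /mu /= /lebesgue_stieltjes_measure /measure_extension.
  rewrite measurable_mu_extE /=; last exact: is_ocitv.
  by rewrite wlength_itv_bnd // EFinB.
have m1 (x : R) : measurable ([set x] : set (measurableTypeR R)) by exact: measurable_set1.
have moc (x y : R) : measurable (`]x, y]%classic : set (measurableTypeR R)) by exact: measurable_itv.
have moo (x y : R) : measurable (`]x, y[%classic : set (measurableTypeR R)) by exact: measurable_itv.
have mub : mu [set b] = 0%E.
  apply/eqP; rewrite eq_le measure_ge0 andbT; apply/lee_addgt0Pr => e e0; rewrite add0e.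
  have /cvgrPdist_le /(_ _ e0)[d /= d0 dP] := cC b.
  apply: (@le_trans _ _ (mu `]b - d / 2, b]%classic)).
    apply: le_measure; rewrite ?inE // => _ ->; rewrite /= in_itv /= lexx andbT.
    by rewrite ltrBlDr ltrDl divr_gt0.
  rewrite ocE; last by rewrite lerBlDr lerDl divr_ge0 // ltW.
  rewrite lee_fin; apply: le_trans (ler_norm _) _; apply: dP.
  by rewrite /ball /= opprB addrC subrK ger0_norm ?divr_ge0 ?ltW // ltr_pdivrMr // ltr_pMr // ltr1n.
move: ab; rewrite le_eqVlt => /predU1P[->|ab].
  rewrite subrr set_itv_ge ?bnd_simp ?ltxx //; exact: measure0.
rewrite -(ocE _ _ (ltW ab)) -(setUitv1 true); last by rewrite bnd_simp.
rewrite measureU //; last first.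
  by apply/seteqP; split => // x [/=]; rewrite in_itv /= => /andP[_ xb] xE; move: xb; rewrite xE ltxx.
by rewrite [X in (_ + X)%E]mub adde0.
Qed.

(** Since the extension by constants does not grow outside the unit interval,
restricting its Stieltjes measure to ]0, 1[ does not change the mass of open
intervals. *)
Lemma stieltjes_measure01 (R : realType) (h : R -> R) :
  {in `[0, 1] &, {homo h : x y / x <= y}} -> {within `[0, 1], continuous h} ->
  exists mu : {finite_measure set (measurableTypeR R) -> \bar R},
    open_itv_increments mu (fun x => h (clamp01 x)) /\
    forall A : set (measurableTypeR R), A `&` `]0, 1[ = set0 -> mu A = 0%E.
Proof.
move=> nh ch; pose H x := h (clamp01 x).
have cH : continuous H by exact: continuous_clamp01.
have nH : {homo H : x y / x <= y}.
  move=> x y xy; apply: nh; rewrite ?clamp01_itv //.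
  by rewrite /clamp01 le_max2 // le_min2.
pose C : cumulative R R := HB.pack H (isCumulative.Build R _ R H nH (right_continuousW cH)).
have mD : measurable (`]0, 1[%classic : set (measurableTypeR R)) by exact: measurable_itv.
have CE := lebesgue_stieltjes_open_itv R C cH.
have fD : (lebesgue_stieltjes_measure C (`]0%R, 1%R[%classic : set (measurableTypeR R)) < +oo)%E.
  by rewrite CE // ltry.
exists (mfrestr mD fD); split; last first.
  move=> A A0; have E : mfrestr mD fD A = lebesgue_stieltjes_measure C set0 by rewrite -A0.
  by apply: (etrans E); exact: measure0.
move=> a b ab.
have clampE : `]a, b[%classic `&` `]0, 1[%classic = `]clamp01 a, clamp01 b[%classic.
  apply/seteqP; split => x /=; rewrite !in_itv /= /clamp01.
    move=> [/andP[ax xb] /andP[x0 x1]].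
    by rewrite gt_max x0 gt_min ax lt_max lt_min xb x1 orbT.
  rewrite gt_max lt_max => /andP[/andP[x0]]; rewrite [x < 0]ltNge (ltW x0) /= lt_min gt_min.
  move=> h1 /andP[xb x1]; rewrite x0 x1 xb andbT; split => //.
  by case/orP: h1 => // h1; have := lt_trans h1 x1; rewrite ltxx.
have E : mfrestr mD fD `]a, b[%classic = lebesgue_stieltjes_measure C `]clamp01 a, clamp01 b[%classic.
  by rewrite -clampE.
apply: (etrans E); rewrite CE; last by rewrite /clamp01 le_max2 // le_min2.
by rewrite /= /H !(clamp01_id _ (clamp01 _)) // clamp01_itv.
Qed.

Lemma continuous_integrable01 (R : realType)
    (mu : {finite_measure set (measurableTypeR R) -> \bar R}) (phi : R -> R) :
  continuous phi -> mu.-integrable `]0, 1[%classic (EFin \o phi).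
Proof.
move=> cphi; apply: measurable_bounded_integrable.
- exact: measurable_itv.
- by rewrite -ge0_fin_numE // fin_num_measure //; exact: measurable_itv.
- by apply: measurable_funTS; exact: continuous_measurable_fun.
- have [c c01 cmax] := @EVT_max R (fun t => `|phi t|) 0 1 ler01
      (continuous_subspaceT (fun x => cvg_norm (cphi x))).
  exists `|phi c|; split; first exact: normr_real.
  move=> M cM z /=; rewrite in_itv /= => /andP[z0 z1].
  apply: le_trans (ltW cM); apply: cmax.
  by rewrite in_itv /= ltW // ltW.
Qed.

(** The Jordan parts and the pair (m1, m2) represent the same charge, so jp +
m2 = m1 + jn as measures; integrating this identity avoids any comparison of
the supports. *)
Lemma charge_Rintegral_sub (R : realType)
    (nu : {charge set (measurableTypeR R) -> \bar R})
    (m1 m2 : {finite_measure set (measurableTypeR R) -> \bar R}) (phi : R -> R) :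
  continuous phi ->
  (forall A : set (measurableTypeR R), measurable A -> nu A = (m1 A - m2 A)%E) ->
  charge_Rintegral nu `]0, 1[ phi = Rintegral m1 `]0, 1[ phi - Rintegral m2 `]0, 1[ phi.
Proof.
move=> cphi nuE; rewrite /charge_Rintegral; set nuPN := (X in jordan_pos X).
pose jp : {finite_measure set (measurableTypeR R) -> \bar R} := jordan_pos nuPN.
pose jn : {finite_measure set (measurableTypeR R) -> \bar R} := jordan_neg nuPN.
change (Rintegral jp `]0, 1[ phi - Rintegral jn `]0, 1[ phi =
  Rintegral m1 `]0, 1[ phi - Rintegral m2 `]0, 1[ phi).
have mD : measurable (`]0, 1[%classic : set (measurableTypeR R)) by exact: measurable_itv.
have int (m : {finite_measure set (measurableTypeR R) -> \bar R}) :
  m.-integrable `]0, 1[%classic (EFin \o phi) by exact: continuous_integrable01.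
have finI (m : {finite_measure set (measurableTypeR R) -> \bar R}) :
    (\int[m]_(x in `]0%R, 1%R[) (phi x)%:E)%E \is a fin_num.
  by apply: integrable_fin_num => //; exact: int.
have E : (\int[jp]_(x in `]0%R, 1%R[) (phi x)%:E + \int[m2]_(x in `]0%R, 1%R[) (phi x)%:E =
   \int[m1]_(x in `]0%R, 1%R[) (phi x)%:E + \int[jn]_(x in `]0%R, 1%R[) (phi x)%:E)%E.
  rewrite -(integral_measure_add mD (int jp) (int m2)) -(integral_measure_add mD (int m1) (int jn)).
  apply: eq_measure_integral => A mA _; rewrite [LHS]measure_addE [RHS]measure_addE.
  suff: (jp A + m2 A = m1 A + jn A)%E by [].
  have : (jp A - jn A)%E = (m1 A - m2 A)%E.
    by rewrite -nuE // (jordan_decomp nuPN mA) /cadd /= cscaleN1.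
  have : jp A \is a fin_num by exact: fin_num_measure.
  have : jn A \is a fin_num by exact: fin_num_measure.
  have : m1 A \is a fin_num by exact: fin_num_measure.
  have : m2 A \is a fin_num by exact: fin_num_measure.
  move=> /fineK <- /fineK <- /fineK <- /fineK <-.
  by rewrite -!EFinB -!EFinD => -[e]; congr EFin; lra.
have := E; rewrite -(fineK (finI jp)) -(fineK (finI m2)) -(fineK (finI m1)) -(fineK (finI jn)).
by rewrite -!EFinD => -[e]; rewrite /Rintegral; lra.
Qed.

Lemma continuous_derive1n (R : realType) (phi : R -> R) n :
  (forall n x, derivable (derive1n n phi) x 1) -> continuous (derive1n n phi).
Proof.
move=> dphi x; apply/differentiable_continuous/derivable1_diffP; exact: dphi.
Qed.

Lemma continuous_lebesgue_integrable01 (R : realType) (h : R -> R) :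
  continuous h -> (@lebesgue_measure R).-integrable `]0, 1[%classic (EFin \o h).
Proof.
move=> ch; have i01 : (@lebesgue_measure R).-integrable `[0, 1]%classic (EFin \o h).
  apply: continuous_compact_integrable; first exact: segment_compact.
  exact: continuous_subspaceT.
have m01 : measurable (`[0, 1]%classic : set (measurableTypeR R)) by exact: measurable_itv.
have mD : measurable (`]0, 1[%classic : set (measurableTypeR R)) by exact: measurable_itv.
apply: (@integrableS _ (measurableTypeR R) R (@lebesgue_measure R) _ _ _ m01 mD _ i01).
by apply: subset_itvW.
Qed.

(** The boundary term of [stieltjes_by_parts] is a multiple of the integral of
the derivative of the test function, which is 0. *)
Lemma Rintegral_test_by_parts (R : realType)
    (mu : {finite_measure set (measurableTypeR R) -> \bar R}) (C phi : R -> R) :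
  open_itv_increments mu C -> continuous C -> test_function01 phi ->
  Rintegral mu `]0, 1[ phi =
  - Rintegral (@lebesgue_measure R) `]0, 1[ (fun x => C x * derive1 phi x).
Proof.
move=> muC cC [dphi [a [b [a0 b1 supp]]]].
pose psi := derive1 phi.
have cpsi : continuous psi by exact: (continuous_derive1n _ _ 1).
have isd (x : R) : is_derive x (1 : R) phi (psi x).
  by rewrite /psi derive1E; apply: derivableP; exact: (dphi 0%N).
have phi0 : phi 0 = 0 by apply: supp; rewrite in_itv /= leNgt a0.
have phi1 : phi 1 = 0 by apply: supp; rewrite in_itv /= [1 <= b]leNgt b1 andbF.
have mD : measurable (`]0, 1[%classic : set (measurableTypeR R)) by exact: measurable_itv.
have := stieltjes_by_parts R mu C phi psi muC isd cpsi phi0.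
rewrite /Rintegral => ->; rewrite -!/(Rintegral _ _ _).
rewrite (_ : (fun x => psi x * (C 1 - C x)) = (fun x => C 1 * psi x - C x * psi x)); last first.
  by apply/funext => x; ring.
rewrite RintegralB //; last 2 first.
- by apply: continuous_lebesgue_integrable01 => x; apply: cvgM; [exact: cvg_cst|exact: cpsi].
- by apply: continuous_lebesgue_integrable01 => x; apply: cvgM; [exact: cC|exact: cpsi].
rewrite RintegralZl //; last exact: continuous_lebesgue_integrable01.
have -> : Rintegral (@lebesgue_measure R) `]0, 1[ psi = 0.
  by rewrite /Rintegral (integral_derivative_itv _ _ _ _ _ isd cpsi ler01) /= phi0 phi1 subrr.
by rewrite mulr0 sub0r.
Qed.

(** * Singularity of the second derivative *)

(** With [v] the total variation of [g] up to [x], both [v] and [v - g] are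
nondecreasing because the variation over an interval dominates the increment.
*)
Lemma bounded_variation_difference (R : realType) (g : R -> R) :
  bounded_variation 0 1 g -> {within `[0, 1], continuous g} ->
  exists v w : R -> R,
    [/\ {in `[0, 1] &, {homo v : x y / x <= y}}, {within `[0, 1], continuous v},
        {in `[0, 1] &, {homo w : x y / x <= y}}, {within `[0, 1], continuous w} &
        forall x, v x - w x = g x].
Proof.
move=> bv cg; pose v x := fine (total_variation 0 x g).
have cv : {within `[0, 1], continuous v} := total_variation_continuous ltr01 cg bv.
have fin x : x \in `[0, 1] -> total_variation 0 x g \is a fin_num.
  rewrite in_itv /= => /andP[x0 x1]; apply/bounded_variationP => //.
  exact: (bounded_variationl x0 x1).
have inc x y : x \in `[0, 1] -> y \in `[0, 1] -> x <= y -> `|g y - g x| <= v y - v x.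
  move=> x01 y01 xy; have x0 : 0 <= x by move: x01; rewrite in_itv /= => /andP[].
  have h := total_variation_ge g xy.
  have E := total_variationD g x0 xy.
  rewrite lerBrDl -lee_fin EFinD /v !fineK ?fin // E.
  by rewrite leeD2l.
exists v, (fun x => v x - g x); split => //.
- move=> x y x01 y01 xy; rewrite -subr_ge0; apply: le_trans (inc _ _ x01 y01 xy).
  exact: normr_ge0.
- move=> x y x01 y01 xy; have := inc _ _ x01 y01 xy; have := ler_norm (g y - g x); lra.
- by move=> x; apply: continuousB; [exact: cv|exact: cg].
- by move=> x; ring.
Qed.

Theorem theorem6p2 (R : realType) (f f' : R -> R)
  (f_C1 : C1_on01 f f')
  (f'_nonconst : ~ exists c : R, forall x, x \in `[0, 1] -> f' x = c)
  (f'_BV : bounded_variation 0 1 f')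
  (Lambda : set (R * R))
  (mLambda : lebesgue_measurable2 Lambda)
  (graph_sub : graph01 f `<=` union_of_lines Lambda)
  (dimE : (hausdorff_dim (union_of_lines Lambda) < 2%:E)%E) :
  exists f'' : {charge set (measurableTypeR R) -> \bar R},
    distributional_derivative01 f' f'' /\ singular_charge f''.
Proof.
case: f_C1 => df cf'.
have [v [w [nv cv nw cw vw]]] := bounded_variation_difference R f' f'_BV cf'.
have [m1 [m1E m1D]] := stieltjes_measure01 R v nv cv.
have [m2 [m2E m2D]] := stieltjes_measure01 R w nw cw.
pose nu : {charge set (measurableTypeR R) -> \bar R} :=
  cadd (charge_of_finite_measure m1) (copp (charge_of_finite_measure m2)).
have nuE (A : set (measurableTypeR R)) : nu A = (m1 A - m2 A)%E by [].
have mD : measurable (`]0, 1[%classic : set (measurableTypeR R)) by exact: measurable_itv.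
have cV := continuous_clamp01 R v cv.
have cW := continuous_clamp01 R w cw.
have cG : continuous (fun x => v (clamp01 x) - w (clamp01 x)).
  by move=> x; apply: cvgB; [exact: cV|exact: cW].
exists nu; split.
  split; first by move=> A mA A0; rewrite nuE m1D // m2D // sube0.
  move=> phi tphi; have [dphi _] := tphi.
  have cphi : continuous phi by exact: (continuous_derive1n R phi 0).
  have cpsi : continuous (derive1 phi) by exact: (continuous_derive1n R phi 1).
  rewrite (charge_Rintegral_sub R nu m1 m2 phi cphi) //.
  rewrite (Rintegral_test_by_parts R m1 _ phi m1E cV tphi) (Rintegral_test_by_parts R m2 _ phi m2E cW tphi).
  rewrite opprB opprK addrC.
  have int (h : R -> R) : continuous h ->
    (@lebesgue_measure R).-integrable `]0, 1[%classic (EFin \o (fun x => h x * derive1 phi x)).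
    move=> ch; apply: continuous_lebesgue_integrable01 => x.
    by apply: cvgM; [exact: ch|exact: cpsi].
  rewrite -RintegralB //; [|exact: int|exact: int].
  apply: eq_Rintegral => x; rewrite inE /= => x01.
  rewrite -mulrBl clamp01_id ?vw //.
  by move: x01; rewrite !in_itv /= => /andP[/ltW -> /ltW ->].
have [N [mN N0 T1N]] := transversal_points_negligible R Lambda f f' dimE df.
exists N; split => // A mA AN.
have restr (m : {finite_measure set (measurableTypeR R) -> \bar R}) :
    (forall A : set (measurableTypeR R), A `&` `]0, 1[ = set0 -> m A = 0%E) ->
    m A = m (A `&` `]0, 1[%classic).
  move=> m0; rewrite [LHS](measureDI m mA mD) [X in (X + _)%E]m0 ?add0e //.
  exact: setDKI.
have AE : m1 (A `&` `]0, 1[%classic) = m2 (A `&` `]0, 1[%classic).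
  apply: (null_image_increments_eq R m1 m2 _ _ _ m1E m2E cG); first exact: measurableI.
  have T2 := tangent_slopes_negligible R Lambda `[0, 1]%classic f f' dimE.
  apply: (@negligibleS _ (measurableTypeR R) R lebesgue_measure _ _ _ T2).
  move=> y [x [Ax /= x01] <-].
  have x01' : x \in `[0, 1].
    by move: x01; rewrite !in_itv /= => /andP[/ltW -> /ltW ->].
  rewrite clamp01_id // vw; exists x => //; split => //.
  have [[a b] /= Lab fx] : union_of_lines Lambda (x, f x).
    by apply: graph_sub; exists x.
  (* outside N the line through the point of the graph is its tangent *)
  have aE : a = f' x.
    apply/eqP; apply: contrapT => /negP na; apply: (AN x Ax); apply: T1N.
    by split => //; exists (a, b).
  by rewrite -aE fx addrC addKr.
apply: (etrans (nuE A)); rewrite (restr m1 m1D) (restr m2 m2D) AE subee // fin_num_measure //.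
exact: measurableI.
Qed.
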